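(* Let $X\in 2^\omega$. Every real $Z$ which is both $X$-Martin-L\''of random and 2-random computes a $\mathrm{DNC}^X$ function which computes no $\mathrm{DNC}_h$ function for any computable $h$.
   Context: $Z$ is $X$-Martin-L\''of random if it is Martin-L\''of random relative to $X$; 2-random means Martin-L\''of random relative to $\emptyset'$. Let $(\phi^Y_n)_n$ be a standard enumeration of the partial $Y$-computable functions $\mathbb{N}\to\mathbb{N}$ ($\phi_n$ without oracle). $f$ is $\mathrm{DNC}^Y$ if $f(n)\neq\phi^Y_n(n)$ for all $n$; $\mathrm{DNC}_h$ is the set of (unrelativized) DNC functions $f$ with $f(n)<h(n)$ for all $n$. ''Computes'' refers to Turing reducibility. *)

(* Defs.v *)
From Stdlib Require Import Arith Lia List Reals ClassicalEpsilon.
From Stdlib Require Cantor.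
From Coquelicot Require Import Coquelicot.

Local Open Scope nat_scope.

Definition npair (x y : nat) : nat := Cantor.to_nat (x, y).

(** Kleene's mu-recursive functions with an oracle, in unary form: several
    arguments are passed as one number through Cantor's pairing bijection. *)
Inductive code : Type :=
| Zero | Succ | Fst | Snd
| Query                       (* x |-> O(x) *)
| Pair (f g : code)           (* x |-> <f(x), g(x)> *)
| Comp (f g : code)           (* x |-> f(g(x)) *)
| Prec (f g : code)           (* <a, 0> |-> f(a);
                                 <a, n+1> |-> g(<a, <n, value at <a, n>>>) *)
| Mu (f : code).              (* x |-> least n such that f(<x, n>) = 0 *)

Fixpoint prim_rec (base : nat -> Prop) (step : nat -> nat -> nat -> Prop)
    (n y : nat) : Prop :=
  match n with
  | 0 => base y
  | S m => exists u, prim_rec base step m u /\ step m u y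
  end.

(** [eval O c] is the graph of the partial function computed by [c] from the
    oracle [O]; divergence is the absence of a value. *)
Fixpoint eval (O : nat -> nat) (c : code) (x y : nat) : Prop :=
  match c with
  | Zero => y = 0
  | Succ => y = S x
  | Fst => y = fst (Cantor.of_nat x)
  | Snd => y = snd (Cantor.of_nat x)
  | Query => y = O x
  | Pair f g => exists u v, eval O f x u /\ eval O g x v /\ y = npair u v
  | Comp f g => exists u, eval O g x u /\ eval O f u y
  | Prec f g =>
      let a := fst (Cantor.of_nat x) in
      prim_rec (eval O f a) (fun n u v => eval O g (npair a (npair n u)) v)
        (snd (Cantor.of_nat x)) y
  | Mu f =>
      eval O f (npair x y) 0 /\
      forall m, m < y -> exists k, eval O f (npair x m) (S k)
  end.

(** An effective bijection between programs and natural numbers; the same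
    numbering serves every oracle. *)
Fixpoint encode (c : code) : nat :=
  match c with
  | Zero => 0
  | Succ => 1
  | Fst => 2
  | Snd => 3
  | Query => 4
  | Pair f g => 5 + 4 * npair (encode f) (encode g)
  | Comp f g => 6 + 4 * npair (encode f) (encode g)
  | Prec f g => 7 + 4 * npair (encode f) (encode g)
  | Mu f => 8 + 4 * encode f
  end.

Lemma npair_inj a b c d : npair a b = npair c d -> a = c /\ b = d.
Proof. unfold npair; intro H; apply Cantor.to_nat_inj in H; now inversion H. Qed.

Lemma encode_inj c d : encode c = encode d -> c = d.
Proof.
revert d; induction c; intros d; destruct d; simpl encode; intro H; try reflexivity; try lia;
 try (assert (E : npair (encode c1) (encode c2) = npair (encode d1) (encode d2)) by lia;
      apply npair_inj in E; destruct E; f_equal; auto).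
f_equal; apply IHc; lia.
Qed.

Lemma encode_surj n : exists c, encode c = n.
Proof.
induction n as [n IH] using lt_wf_ind.
destruct (le_lt_dec 5 n) as [L|L].
2:{ destruct n as [|[|[|[|[|]]]]]; [exists Zero|exists Succ|exists Fst|exists Snd|exists Query|lia]; reflexivity. }
pose proof (Nat.div_mod_eq (n-5) 4). pose proof (Nat.mod_upper_bound (n-5) 4 ltac:(lia)).
set (q := (n-5)/4) in *. set (r := (n-5) mod 4) in *.
destruct (Cantor.of_nat q) as [i j] eqn:E.
assert (P : npair i j = q) by (unfold npair; rewrite <- E; apply Cantor.cancel_to_of).
assert (i + j <= q) by (rewrite <- P; unfold npair; pose proof (Cantor.to_nat_non_decreasing i j); lia).
destruct (IH i) as [ci Hi]; [lia|]. destruct (IH j) as [cj Hj]; [lia|]. destruct (IH q) as [cq Hq]; [lia|].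
assert (r=0\/r=1\/r=2\/r=3) as [|[|[|]]] by lia;
 [exists (Pair ci cj)|exists (Comp ci cj)|exists (Prec ci cj)|exists (Mu cq)]; simpl encode;
 rewrite ?Hi, ?Hj, ?Hq, ?P; lia.
Qed.

Lemma eval_functional O c : forall x y z, eval O c x y -> eval O c x z -> y = z.
Proof.
induction c; simpl; intros x y z H1 H2; try congruence.
- destruct H1 as (u&v&?&?&->), H2 as (u'&v'&?&?&->). f_equal; eauto.
- destruct H1 as (u&?&?), H2 as (u'&?&?). assert (u=u') by eauto. subst; eauto.
- revert y z H1 H2. induction (snd (Cantor.of_nat x)); simpl; intros y z H1 H2; eauto.
  destruct H1 as (u&?&?), H2 as (u'&?&?). assert (u=u') by eauto. subst; eauto.
- destruct H1 as [A B], H2 as [C D]. destruct (lt_eq_lt_dec y z) as [[L|L]|L]; auto; exfalso.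
  + destruct (D _ L) as [k K]. specialize (IHc _ _ _ A K); lia.
  + destruct (B _ L) as [k K]. specialize (IHc _ _ _ C K); lia.
Qed.

(** [phi O n x y] means that the [n]-th partial [O]-computable function is
    defined at [x] with value [y]. *)
Definition phi (O : nat -> nat) (n x y : nat) : Prop :=
  exists c, encode c = n /\ eval O c x y.

Definition computable_in (O f : nat -> nat) : Prop :=
  exists n, forall x, phi O n x (f x).

(** Elements of Cantor space, used as oracles through their characteristic
    function. *)
Definition binseq : Type := nat -> bool.

Definition char (X : binseq) : nat -> nat := fun n => Nat.b2n (X n).

Definition empty : binseq := fun _ => false.

Definition computable (f : nat -> nat) : Prop := computable_in (char empty) f.

Definition jump (X : binseq) : binseq := fun n =>
  if excluded_middle_informative (exists y, phi (char X) n n y)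
  then true else false.

(** Bijective binary numeration. *)
Fixpoint string_code (s : list bool) : nat :=
  match s with
  | nil => 0
  | b :: s' => 2 * string_code s' + (if b then 2 else 1)
  end.

Definition cylinder (s : list bool) (Z : binseq) : Prop :=
  map Z (seq 0 (length s)) = s.

Definition open_class (W : list bool -> Prop) (Z : binseq) : Prop :=
  exists s, W s /\ cylinder s Z.

(** The outer measure induced by giving the cylinder of [s] the mass
    [2 ^ - length s]: the uniform measure on Cantor space, extended to all
    classes. It is applied to open classes only. *)
Definition measure (A : binseq -> Prop) : Rbar :=
  Glb_Rbar (fun r => exists s : nat -> list bool,
    (forall Z, A Z -> exists k, cylinder (s k) Z) /\
    is_series (fun k => ((/ 2) ^ length (s k))%R) r).

Definition uniformly_ce (O : nat -> nat) (W : nat -> list bool -> Prop) : Prop :=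
  exists e, forall n s,
    W n s <-> exists y, phi O e (npair n (string_code s)) y.

Definition ML_test (O : nat -> nat) (W : nat -> list bool -> Prop) : Prop :=
  uniformly_ce O W /\
  forall n, Rbar_le (measure (open_class (W n))) (Finite ((/ 2) ^ n)%R).

Definition ML_random (X Z : binseq) : Prop :=
  forall W, ML_test (char X) W -> ~ (forall n, open_class (W n) Z).

Definition two_random (Z : binseq) : Prop := ML_random (jump empty) Z.

Definition DNC (X : binseq) (f : nat -> nat) : Prop :=
  forall n, ~ phi (char X) n n (f n).

Definition DNC_bounded (h f : nat -> nat) : Prop :=
  DNC empty f /\ forall n, f n < h n.

(* Main.v *)
(** The proof combines bushy tree forcing with a fireworks argument. A
    randomized process, fed with the bits of [Z], extends a finite string [s] (the
    stem of [f]) by values drawn from sets so large that, with high probability,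
    [f] avoids the values [phi_l^X(l)] and avoids every set of strings that was not
    bushy above the stem when the process promised to avoid it.

    For a functional [a] and an index [b] of a bound [h], the process computes an
    [e] such that [phi_e(e)] is a value [v], if there is one, for which the strings
    [t] with [phi_a^t(e) = v] are [j]-bushy above [s]. If [h(e)] converges and no
    such [v] exists, then by the pigeonhole principle the strings [t] with
    [phi_a^t(e) < h(e)] are not [(j + h(e))]-bushy above [s], and drawing from larger
    sets from now on makes [phi_a^f(e) < h(e)] unlikely. Otherwise the process can
    walk to a leaf of the bushy tree, so that [phi_a^f(e) = phi_e(e)].

    The process cannot decide which case holds. At each attempt it tosses coins:
    usually it assumes that [h(e)] diverges, with chance [p] it waits for [h(e)]
    and then assumes that there is no tree, and with chance [p^2] it waits for the
    tree. A refuted assumption leads to a new attempt, and the chance of ever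
    waiting in vain, or of attempting forever, is [O(p)]. The halting problem
    detects each failure, so a 2-random [Z] makes one of the processes succeed. *)

From Stdlib Require Import Arith Lia List Bool Classical ClassicalEpsilon Reals Lra.
From Stdlib Require Cantor.
From Coquelicot Require Import Coquelicot.
Require Import Defs.
Import ListNotations.
Local Open Scope nat_scope.

(** * Computability of functions between encoded types *)

Arguments npair : simpl never.
Arguments Cantor.to_nat : simpl never.
Arguments Cantor.of_nat : simpl never.

Lemma npair_of_nat n : npair (fst (Cantor.of_nat n)) (snd (Cantor.of_nat n)) = n.
Proof. unfold npair. rewrite <- surjective_pairing. apply Cantor.cancel_to_of. Qed.

Lemma of_nat_npair a b : Cantor.of_nat (npair a b) = (a, b).
Proof. apply Cantor.cancel_of_to. Qed.

Class Enc (A : Type) := {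
  enc : A -> nat;
  dec : nat -> A;
  dec_enc : forall a, dec (enc a) = a }.

Class Onto (A : Type) `{Enc A} := enc_dec : forall n, enc (dec n : A) = n.

#[export] Instance enc_nat : Enc nat :=
  {| enc n := n; dec n := n; dec_enc n := eq_refl |}.
#[export] Instance onto_nat : Onto nat := fun n => eq_refl.

#[export, refine] Instance enc_bool : Enc bool :=
  {| enc b := Nat.b2n b; dec n := negb (n =? 0) |}.
Proof. now intros []. Defined.

#[export, refine] Instance enc_prod {A B} `{Enc A} `{Enc B} : Enc (A * B) :=
  {| enc p := npair (enc (fst p)) (enc (snd p));
     dec n := (dec (fst (Cantor.of_nat n)), dec (snd (Cantor.of_nat n))) |}.
Proof.
  intros [a b]; simpl. rewrite of_nat_npair; simpl. now rewrite !dec_enc.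
Defined.

#[export] Instance onto_prod {A B} `{Onto A} `{Onto B} : Onto (A * B).
Proof. intro n; simpl. rewrite !enc_dec. apply npair_of_nat. Qed.

Lemma npair_le_r a b : b <= npair a b.
Proof. unfold npair. pose proof (Cantor.to_nat_non_decreasing a b). lia. Qed.

Fixpoint enc_list {A} `{Enc A} (l : list A) : nat :=
  match l with
  | [] => 0
  | x :: l' => S (npair (enc x) (enc_list l'))
  end.

Fixpoint dec_list {A} `{Enc A} (fuel n : nat) : list A :=
  match fuel, n with
  | S fuel', S m =>
      dec (fst (Cantor.of_nat m)) :: dec_list fuel' (snd (Cantor.of_nat m))
  | _, _ => []
  end.

#[export, refine] Instance enc_listI {A} `{Enc A} : Enc (list A) :=
  {| enc := enc_list; dec n := dec_list n n |}.
Proof.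
  enough (K : forall l k, enc_list l <= k -> dec_list k (enc_list l) = l) by
    (intro l; now apply K).
  induction l as [|x l IH]; intros [|k]; simpl; try easy; try lia.
  intro L. rewrite of_nat_npair; simpl. rewrite dec_enc, IH; [easy|].
  pose proof (npair_le_r (enc x) (enc_list l)). lia.
Defined.

#[export] Instance onto_list {A} `{Onto A} : Onto (list A).
Proof.
  enough (K : forall k n, n <= k -> enc_list (dec_list k n : list A) = n) by
    (intro n; now apply K).
  induction k as [|k IH]; intros [|n] L; simpl; try easy; try lia.
  rewrite enc_dec, IH; [now rewrite npair_of_nat|].
  pose proof (npair_le_r (fst (Cantor.of_nat n)) (snd (Cantor.of_nat n))).
  rewrite npair_of_nat in *. lia.
Qed.

Lemma enc_inj {A} `{Enc A} (a b : A) : enc a = enc b -> a = b.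
Proof. intro E. now rewrite <- (dec_enc a), E, dec_enc. Qed.

Lemma enc_list_length {A} `{Enc A} (l : list A) : length l <= enc l.
Proof.
  induction l as [|x l IH]; simpl in *; [lia|].
  pose proof (npair_le_r (enc x) (enc_list l)). lia.
Qed.

Definition effective (O : nat -> nat) {A B} `{Enc A} `{Enc B} (f : A -> B) : Prop :=
  exists c, forall a, eval O c (enc a) (enc (f a)).

Fixpoint const_code (k : nat) : code :=
  match k with
  | 0 => Zero
  | S k' => Comp Succ (const_code k')
  end.

Lemma eval_const_code O k x : eval O (const_code k) x k.
Proof. induction k; simpl; [easy|]. now exists k. Qed.

Definition id_code : code := Pair Fst Snd.

Lemma eval_id_code O x : eval O id_code x x.
Proof.
  exists (fst (Cantor.of_nat x)), (snd (Cantor.of_nat x)).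
  now rewrite npair_of_nat.
Qed.

Section Comp.
Context {O : nat -> nat} {A B C D : Type} `{Enc A} `{Enc B} `{Enc C} `{Enc D}.

Lemma comp_ext (f g : A -> B) : (forall x, f x = g x) -> effective O f -> effective O g.
Proof. intros E [c Hc]. exists c. intro a. now rewrite <- E. Qed.

Lemma comp_id : effective O (fun x : A => x).
Proof. exists id_code. intro. apply eval_id_code. Qed.

Lemma comp_const (b : B) : effective O (fun _ : A => b).
Proof. exists (const_code (enc b)). intro. apply eval_const_code. Qed.

Lemma comp_comp (g : B -> C) (f : A -> B) :
  effective O g -> effective O f -> effective O (fun x => g (f x)).
Proof.
  intros [c Hc] [d Hd]. exists (Comp c d). intro a. now exists (enc (f a)).
Qed.

Lemma comp_pair (f : A -> B) (g : A -> C) :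
  effective O f -> effective O g -> effective O (fun x => (f x, g x)).
Proof.
  intros [c Hc] [d Hd]. exists (Pair c d). intro a. simpl.
  now exists (enc (f a)), (enc (g a)).
Qed.

Lemma comp_fst (f : A -> B * C) : effective O f -> effective O (fun x => fst (f x)).
Proof.
  intros [c Hc]. exists (Comp Fst c). intro a. exists (enc (f a)).
  split; [easy|]. simpl. now rewrite of_nat_npair.
Qed.

Lemma comp_snd (f : A -> B * C) : effective O f -> effective O (fun x => snd (f x)).
Proof.
  intros [c Hc]. exists (Comp Snd c). intro a. exists (enc (f a)).
  split; [easy|]. simpl. now rewrite of_nat_npair.
Qed.

Lemma comp_enc (f : A -> B) : effective O f -> effective O (fun x => enc (f x)).
Proof. intros [c Hc]. now exists c. Qed.

Lemma comp_dec `{!Onto B} (f : A -> nat) : effective O f -> effective O (fun x => dec (f x) : B).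
Proof. intros [c Hc]. exists c. intro a. rewrite enc_dec. apply Hc. Qed.

Lemma comp_succ (f : A -> nat) : effective O f -> effective O (fun x => S (f x)).
Proof. intros [c Hc]. exists (Comp Succ c). intro a. now exists (f a). Qed.

Lemma comp_query (f : A -> nat) : effective O f -> effective O (fun x => O (f x)).
Proof. intros [c Hc]. exists (Comp Query c). intro a. now exists (f a). Qed.

Lemma comp_nat_rect (b : A -> B) (s : A -> nat -> B -> B) (k : A -> nat) :
  effective O b -> effective O (fun p : A * (nat * B) => s (fst p) (fst (snd p)) (snd (snd p))) ->
  effective O k -> effective O (fun x => nat_rect (fun _ => B) (b x) (s x) (k x)).
Proof.
  intros [cb Hb] [cs Hs] [ck Hk].
  exists (Comp (Prec cb cs) (Pair id_code ck)). intro a.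
  exists (npair (enc a) (k a)). split.
  - exists (enc a), (k a). repeat split; [apply eval_id_code|apply Hk].
  - simpl. rewrite of_nat_npair; simpl.
    induction (k a) as [|n IH]; simpl; [apply Hb|].
    eexists; split; [apply IH|]. apply (Hs (a, (n, _))).
Qed.
End Comp.

Ltac comp_eta :=
  lazymatch goal with
  | |- @effective ?O ?A ?B ?EA ?EB ?f =>
      lazymatch f with
      | fun _ => _ => fail
      | _ => change (@effective O A B EA EB (fun x => f x))
      end
  end.

Create HintDb cmp discriminated.
#[export] Hint Extern 0 (effective _ _) => comp_eta : cmp.
#[export] Hint Extern 0 (effective _ (fun x => ?b)) => exact (comp_const b) : cmp.
#[export] Hint Extern 0 (effective _ (fun x => x)) => apply comp_id : cmp.
#[export] Hint Extern 1 (effective _ (fun x => (_, _))) => apply comp_pair : cmp.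
#[export] Hint Extern 1 (effective _ (fun x => fst _)) => apply comp_fst : cmp.
#[export] Hint Extern 1 (effective _ (fun x => snd _)) => apply comp_snd : cmp.
#[export] Hint Extern 1 (effective _ (fun x => enc _)) => apply comp_enc : cmp.
#[export] Hint Extern 1 (effective _ (fun x => dec _)) => apply comp_dec : cmp.
#[export] Hint Extern 1 (effective _ (fun x => S _)) => apply comp_succ : cmp.
Ltac cmp := cbv beta; auto 100 with cmp nocore.

Lemma comp_recode {O A B} `{Enc A} `{Enc B} (f : A -> nat) (g : A -> B) :
  (forall x, f x = enc (g x)) -> effective O f -> effective O g.
Proof. intros E [c Hc]. exists c. intro a. rewrite <- E. apply Hc. Qed.

Lemma comp_app2 {O A B C D} `{Enc A} `{Enc B} `{Enc C} `{Enc D}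
  (op : B -> C -> D) (f : A -> B) (g : A -> C) :
  effective O (fun p : B * C => op (fst p) (snd p)) -> effective O f -> effective O g ->
  effective O (fun x => op (f x) (g x)).
Proof.
  intros Ho Hf Hg.
  apply (comp_comp (fun p => op (fst p) (snd p)) (fun x => (f x, g x)) Ho). cmp.
Qed.

Lemma comp_app3 {O A B C D E} `{Enc A} `{Enc B} `{Enc C} `{Enc D} `{Enc E}
  (op : B -> C -> D -> E) (f : A -> B) (g : A -> C) (h : A -> D) :
  effective O (fun p : B * (C * D) => op (fst p) (fst (snd p)) (snd (snd p))) ->
  effective O f -> effective O g -> effective O h -> effective O (fun x => op (f x) (g x) (h x)).
Proof.
  intros Ho Hf Hg Hh.
  apply (comp_comp (fun p => op (fst p) (fst (snd p)) (snd (snd p)))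
    (fun x => (f x, (g x, h x))) Ho). cmp.
Qed.

Lemma comp_of_nat {O A} `{Enc A}
  (f : A -> nat) : effective O f -> effective O (fun x => Cantor.of_nat (f x)).
Proof.
  apply comp_recode. intro x. cbn. symmetry. apply npair_of_nat.
Qed.
#[export] Hint Extern 1 (effective _ (fun x => Cantor.of_nat _)) => apply comp_of_nat : cmp.

Lemma comp_npair {O A} `{Enc A} (f g : A -> nat) :
  effective O f -> effective O g -> effective O (fun x => npair (f x) (g x)).
Proof.
  intros Hf Hg. apply (comp_ext (fun x => enc (f x, g x))); [easy|]. cmp.
Qed.
#[export] Hint Extern 1 (effective _ (fun x => npair _ _)) => apply comp_npair : cmp.

Lemma comp_match_nat {O A} `{Enc A} {B} `{Enc B} (f : A -> nat) (a : A -> B) (b : A -> nat -> B) :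
  effective O (fun p : A * nat => b (fst p) (snd p)) -> effective O f -> effective O a ->
  effective O (fun x => match f x with 0 => a x | S m => b x m end).
Proof.
  intros Hb Hf Ha.
  apply (comp_ext (fun x => nat_rect (fun _ => B) (a x) (fun m _ => b x m) (f x))).
  { intro x. now destruct (f x). }
  apply (comp_nat_rect _ (fun x m _ => b x m)); [easy| |easy].
  apply (comp_app2 b); cmp.
Qed.
#[export] Hint Extern 1 (effective _ (fun x => ?f (@?g x))) =>
  is_var f; apply (comp_comp f g) : cmp.
#[export] Hint Extern 1 (effective _ (fun x => match _ with 0 => _ | S _ => _ end)) =>
  apply comp_match_nat : cmp.

Lemma comp_if {O A} `{Enc A} {B} `{Enc B} (b : A -> bool) (f g : A -> B) :
  effective O b -> effective O f -> effective O g -> effective O (fun x => if b x then f x else g x).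
Proof.
  intros Hb Hf Hg.
  apply (comp_ext (fun x => match enc (b x) with 0 => g x | S _ => f x end)).
  { intro x. now destruct (b x). }
  apply comp_match_nat; [|cmp..].
  apply (comp_comp f fst); cmp.
Qed.
#[export] Hint Extern 1 (effective _ (fun x => if _ then _ else _)) => apply comp_if : cmp.

Lemma comp_pred {O A} `{Enc A} (f : A -> nat) : effective O f -> effective O (fun x => pred (f x)).
Proof.
  intro Hf. apply (comp_ext (fun x => match f x with 0 => 0 | S m => m end)).
  { intro x. now destruct (f x). }
  apply comp_match_nat; cmp.
Qed.
#[export] Hint Extern 1 (effective _ (fun x => pred _)) => apply comp_pred : cmp.

Lemma comp_add {O A} `{Enc A}
  (f g : A -> nat) : effective O f -> effective O g -> effective O (fun x => f x + g x).
Proof.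
  intros Hf Hg.
  apply (comp_ext (fun x => nat_rect (fun _ => nat) (f x) (fun _ u => S u) (g x))).
  { intro x. induction (g x); cbn; lia. }
  apply (comp_nat_rect f (fun _ _ u => S u) g); cmp.
Qed.
#[export] Hint Extern 1 (effective _ (fun x => _ + _)) => apply comp_add : cmp.

Lemma comp_sub {O A} `{Enc A}
  (f g : A -> nat) : effective O f -> effective O g -> effective O (fun x => f x - g x).
Proof.
  intros Hf Hg.
  apply (comp_ext (fun x => nat_rect (fun _ => nat) (f x) (fun _ u => pred u) (g x))).
  { intro x. induction (g x); cbn; lia. }
  apply (comp_nat_rect f (fun _ _ u => pred u) g); cmp.
Qed.
#[export] Hint Extern 1 (effective _ (fun x => _ - _)) => apply comp_sub : cmp.

Lemma comp_eq0 {O A} `{Enc A} (f : A -> nat) : effective O f -> effective O (fun x => f x =? 0).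
Proof.
  intro Hf. apply (comp_ext (fun x => match f x with 0 => true | S _ => false end)).
  { intro x. now destruct (f x). }
  apply comp_match_nat; cmp.
Qed.

Lemma comp_andb {O A} `{Enc A}
  (f g : A -> bool) : effective O f -> effective O g -> effective O (fun x => f x && g x).
Proof. intros; apply comp_if; cmp. Qed.
#[export] Hint Extern 1 (effective _ (fun x => _ && _)) => apply comp_andb : cmp.

Lemma comp_orb {O A} `{Enc A}
  (f g : A -> bool) : effective O f -> effective O g -> effective O (fun x => f x || g x).
Proof. intros; apply comp_if; cmp. Qed.
#[export] Hint Extern 1 (effective _ (fun x => _ || _)) => apply comp_orb : cmp.

Lemma comp_negb {O A} `{Enc A} (f : A -> bool) : effective O f -> effective O (fun x => negb (f x)).
Proof. intros; apply comp_if; cmp. Qed.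
#[export] Hint Extern 1 (effective _ (fun x => negb _)) => apply comp_negb : cmp.

Lemma comp_leb {O A} `{Enc A}
  (f g : A -> nat) : effective O f -> effective O g -> effective O (fun x => f x <=? g x).
Proof.
  intros Hf Hg. apply (comp_ext (fun x => f x - g x =? 0)).
  { intro x. apply eq_true_iff_eq. rewrite Nat.eqb_eq, Nat.leb_le. lia. }
  now apply comp_eq0, comp_sub.
Qed.
#[export] Hint Extern 1 (effective _ (fun x => _ <=? _)) => apply comp_leb : cmp.

Lemma comp_ltb {O A} `{Enc A}
  (f g : A -> nat) : effective O f -> effective O g -> effective O (fun x => f x <? g x).
Proof. intros; apply comp_leb; cmp. Qed.
#[export] Hint Extern 1 (effective _ (fun x => _ <? _)) => apply comp_ltb : cmp.

Lemma comp_eqb {O A} `{Enc A}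
  (f g : A -> nat) : effective O f -> effective O g -> effective O (fun x => f x =? g x).
Proof.
  intros Hf Hg. apply (comp_ext (fun x => (f x <=? g x) && (g x <=? f x))).
  { intro x. apply eq_true_iff_eq. rewrite andb_true_iff, Nat.eqb_eq, !Nat.leb_le. lia. }
  now apply comp_andb; apply comp_leb.
Qed.
#[export] Hint Extern 1 (effective _ (fun x => _ =? _)) => apply comp_eqb : cmp.

Lemma comp_mul {O A} `{Enc A}
  (f g : A -> nat) : effective O f -> effective O g -> effective O (fun x => f x * g x).
Proof.
  intros Hf Hg.
  apply (comp_ext (fun x => nat_rect (fun _ => nat) 0 (fun _ u => u + f x) (g x))).
  { intro x. induction (g x); cbn; lia. }
  apply (comp_nat_rect (fun _ => 0) (fun x _ u => u + f x) g); cmp.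
Qed.
#[export] Hint Extern 1 (effective _ (fun x => _ * _)) => apply comp_mul : cmp.

Lemma comp_pow {O A} `{Enc A}
  (f g : A -> nat) : effective O f -> effective O g -> effective O (fun x => f x ^ g x).
Proof.
  intros Hf Hg.
  apply (comp_ext (fun x => nat_rect (fun _ => nat) 1 (fun _ u => f x * u) (g x))).
  { intro x. induction (g x); cbn; lia. }
  apply (comp_nat_rect (fun _ => 1) (fun x _ u => f x * u) g); cmp.
Qed.
#[export] Hint Extern 1 (effective _ (fun x => _ ^ _)) => apply comp_pow : cmp.

Lemma comp_cons {O A B} `{Enc A} `{Enc B} (f : A -> B) (g : A -> list B) :
  effective O f -> effective O g -> effective O (fun x => f x :: g x).
Proof.
  intros Hf Hg. apply (comp_recode (fun x => S (enc (f x, g x)))); [easy|]. cmp.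
Qed.
#[export] Hint Extern 1 (effective _ (fun x => _ :: _)) => apply comp_cons : cmp.

Lemma comp_tl {O A B} `{Enc A} `{Enc B}
  (f : A -> list B) : effective O f -> effective O (fun x => tl (f x)).
Proof.
  intro Hf. apply (comp_recode (fun x => snd (Cantor.of_nat (pred (enc (f x)))))); [|cmp].
  intro x. destruct (f x); [easy|]. cbn. now rewrite of_nat_npair.
Qed.
#[export] Hint Extern 1 (effective _ (fun x => tl _)) => apply comp_tl : cmp.

Lemma comp_hd {O A B} `{Enc A} `{Enc B}
  (d : B) (f : A -> list B) : effective O f -> effective O (fun x => hd d (f x)).
Proof.
  intro Hf. apply (comp_recode (fun x => if enc (f x) =? 0 then enc d else
    fst (Cantor.of_nat (pred (enc (f x)))))); [|cmp].
  intro x. destruct (f x); [easy|]. cbn. now rewrite of_nat_npair.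
Qed.
#[export] Hint Extern 1 (effective _ (fun x => hd _ _)) => apply comp_hd : cmp.

Lemma comp_match_list {O A B C} `{Enc A} `{Enc B} `{Enc C}
  (l : A -> list B) (n : A -> C) (k : A -> B -> list B -> C) :
  effective O (fun p : A * (B * list B) => k (fst p) (fst (snd p)) (snd (snd p))) ->
  effective O l -> effective O n ->
  effective O (fun x => match l x with [] => n x | b :: l' => k x b l' end).
Proof.
  intros Hk Hl Hn.
  apply (comp_ext (fun x =>
    if enc (l x) =? 0 then n x else k x (hd (dec 0) (l x)) (tl (l x)))).
  { intro x. now destruct (l x). }
  apply comp_if; [cmp..|].
  apply (comp_app3 k); [easy|cmp| |]; [now apply comp_hd|now apply comp_tl].
Qed.

Lemma nat_rect_fold_left {B C} (F : B -> C -> B) l i n :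
  nat_rect (fun _ => (B * list C)%type) (i, l)
    (fun _ p => match snd p with [] => p | c :: l' => (F (fst p) c, l') end) n
  = (fold_left F (firstn n l) i, skipn n l).
Proof.
  induction n as [|n IH]; [easy|]. cbn [nat_rect]. rewrite IH. cbn.
  clear IH. revert i l. induction n as [|n IH]; intros i [|c l]; cbn; try easy.
Qed.

Lemma comp_fold_left {O A B C} `{Enc A} `{Enc B} `{Enc C}
  (F : A -> B -> C -> B) (l : A -> list C) (i : A -> B) :
  effective O (fun p : A * (B * C) => F (fst p) (fst (snd p)) (snd (snd p))) ->
  effective O l -> effective O i -> effective O (fun x => fold_left (F x) (l x) (i x)).
Proof.
  intros HF Hl Hi.
  apply (comp_ext (fun x => fst (nat_rect (fun _ => (B * list C)%type) (i x, l x)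
    (fun _ p => match snd p with [] => p | c :: l' => (F x (fst p) c, l') end)
    (enc (l x))))).
  { intro x.
    rewrite nat_rect_fold_left, firstn_all2; [easy|]. apply enc_list_length. }
  apply comp_fst.
  apply (comp_nat_rect (fun x => (i x, l x)) (fun x _ p =>
    match snd p with [] => p | c :: l' => (F x (fst p) c, l') end)); [cmp| |cmp].
  apply (comp_match_list (fun p : A * (nat * (B * list C)) => snd (snd (snd p)))
    (fun p => snd (snd p)) (fun p c l' => (F (fst p) (fst (snd (snd p))) c, l'))); [|cmp..].
  apply comp_pair; [|cmp]. apply (comp_app3 F); [easy|cmp..].
Qed.
#[export] Hint Extern 1 (effective _ (fun x => fold_left _ _ _)) => apply comp_fold_left : cmp.

Lemma comp_rev {O A C} `{Enc A} `{Enc C}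
  (l : A -> list C) : effective O l -> effective O (fun x => rev (l x)).
Proof.
  intro Hl. apply (comp_ext (fun x => fold_left (fun acc c => c :: acc) (l x) [])).
  { intro x. rewrite <- fold_left_rev_right. rewrite <- (app_nil_r (rev (l x))).
    generalize (rev (l x)). induction l0; cbn; congruence. }
  apply (comp_fold_left (fun _ acc c => c :: acc)); cmp.
Qed.
#[export] Hint Extern 1 (effective _ (fun x => rev _)) => apply comp_rev : cmp.

Lemma comp_fold_right {O A B C} `{Enc A} `{Enc B} `{Enc C}
  (F : A -> C -> B -> B) (l : A -> list C) (i : A -> B) :
  effective O (fun p : A * (C * B) => F (fst p) (fst (snd p)) (snd (snd p))) ->
  effective O l -> effective O i -> effective O (fun x => fold_right (F x) (i x) (l x)).
Proof.
  intros HF Hl Hi.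
  apply (comp_ext (fun x => fold_left (fun b c => F x c b) (rev (l x)) (i x))).
  { intro x. now rewrite <- fold_left_rev_right, rev_involutive. }
  apply (comp_fold_left (fun x b c => F x c b)); [|now apply comp_rev|cmp].
  apply (comp_app3 F); [easy|cmp..].
Qed.
#[export] Hint Extern 1 (effective _ (fun x => fold_right _ _ _)) => apply comp_fold_right : cmp.

Lemma comp_app {O A C} `{Enc A} `{Enc C}
  (f g : A -> list C) : effective O f -> effective O g -> effective O (fun x => f x ++ g x).
Proof.
  intros Hf Hg. apply (comp_ext (fun x => fold_right (fun c l => c :: l) (g x) (f x))).
  { intro x. induction (f x); cbn; congruence. }
  apply (comp_fold_right (fun _ c l => c :: l)); cmp.
Qed.
#[export] Hint Extern 1 (effective _ (fun x => _ ++ _)) => apply comp_app : cmp.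

Lemma comp_length {O A C} `{Enc A} `{Enc C}
  (f : A -> list C) : effective O f -> effective O (fun x => length (f x)).
Proof.
  intros Hf. apply (comp_ext (fun x => fold_right (fun c l => S l) 0 (f x))).
  { intro x. induction (f x); cbn; congruence. }
  apply (comp_fold_right (fun _ c l => S l)); cmp.
Qed.
#[export] Hint Extern 1 (effective _ (fun x => length _)) => apply comp_length : cmp.

Lemma comp_map {O A B C} `{Enc A} `{Enc B} `{Enc C} (F : A -> C -> B) (l : A -> list C) :
  effective O (fun p : A * C => F (fst p) (snd p)) -> effective O l ->
  effective O (fun x => map (F x) (l x)).
Proof.
  intros HF Hl.
  apply (comp_ext (fun x => fold_right (fun c l => F x c :: l) [] (l x))).
  { intro x. induction (l x); cbn; congruence. }
  apply (comp_fold_right (fun x c l => F x c :: l)); try cmp.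
  apply comp_cons; [apply (comp_app2 F)|]; cmp.
Qed.
#[export] Hint Extern 1 (effective _ (fun x => map _ _)) => apply comp_map : cmp.

Lemma comp_existsb {O A C} `{Enc A} `{Enc C} (F : A -> C -> bool) (l : A -> list C) :
  effective O (fun p : A * C => F (fst p) (snd p)) -> effective O l ->
  effective O (fun x => existsb (F x) (l x)).
Proof.
  intros HF Hl.
  apply (comp_ext (fun x => fold_right (fun c b => F x c || b) false (l x))).
  { intro x. induction (l x); cbn; congruence. }
  apply (comp_fold_right (fun x c b => F x c || b)); try cmp.
  apply comp_orb; [apply (comp_app2 F)|]; cmp.
Qed.
#[export] Hint Extern 1 (effective _ (fun x => existsb _ _)) => apply comp_existsb : cmp.

Lemma comp_forallb {O A C} `{Enc A} `{Enc C} (F : A -> C -> bool) (l : A -> list C) :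
  effective O (fun p : A * C => F (fst p) (snd p)) -> effective O l ->
  effective O (fun x => forallb (F x) (l x)).
Proof.
  intros HF Hl.
  apply (comp_ext (fun x => fold_right (fun c b => F x c && b) true (l x))).
  { intro x. induction (l x); cbn; congruence. }
  apply (comp_fold_right (fun x c b => F x c && b)); try cmp.
  apply comp_andb; [apply (comp_app2 F)|]; cmp.
Qed.
#[export] Hint Extern 1 (effective _ (fun x => forallb _ _)) => apply comp_forallb : cmp.

Lemma comp_filter {O A C} `{Enc A} `{Enc C} (F : A -> C -> bool) (l : A -> list C) :
  effective O (fun p : A * C => F (fst p) (snd p)) -> effective O l ->
  effective O (fun x => filter (F x) (l x)).
Proof.
  intros HF Hl.
  apply (comp_ext (fun x => fold_right (fun c l => if F x c then c :: l else l) [] (l x))).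
  { intro x. induction (l x); cbn; [easy|]. now rewrite IHl0. }
  apply (comp_fold_right (fun x c l => if F x c then c :: l else l)); try cmp.
  apply comp_if; [apply (comp_app2 F)|..]; try cmp.
Qed.
#[export] Hint Extern 1 (effective _ (fun x => filter _ _)) => apply comp_filter : cmp.

Lemma comp_nth {O A C} `{Enc A} `{Enc C} (i : A -> nat) (l : A -> list C) (d : C) :
  effective O i -> effective O l -> effective O (fun x => nth (i x) (l x) d).
Proof.
  intros Hi Hl.
  apply (comp_ext (fun x => hd d (nat_rect (fun _ => list C) (l x) (fun _ l => tl l) (i x)))).
  { intro x. generalize (l x). induction (i x) as [|n IH]; intros [|c l']; cbn; try easy.
    - clear. assert (nat_rect (fun _ => list C) [] (fun _ l => tl l) n = []) as ->; [|easy].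
      induction n as [|n IH]; cbn; [easy|]. now rewrite IH.
    - rewrite <- IH. f_equal. clear. induction n as [|n IH]; cbn in *; [easy|]. now rewrite <- IH. }
  apply comp_hd, (comp_nat_rect l (fun _ _ l => tl l) i); cmp.
Qed.
#[export] Hint Extern 1 (effective _ (fun x => nth _ _ _)) => apply comp_nth : cmp.

Lemma comp_seq {O A} `{Enc A}
  (a n : A -> nat) : effective O a -> effective O n -> effective O (fun x => seq (a x) (n x)).
Proof.
  intros Ha Hn.
  apply (comp_ext (fun x => nat_rect (fun _ => list nat) [] (fun k l => l ++ [a x + k]) (n x))).
  { intro x. induction (n x) as [|k IH]; [easy|]. rewrite seq_S. cbn. now rewrite IH. }
  apply (comp_nat_rect (fun _ => []) (fun x k l => l ++ [a x + k]) n); try cmp.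
Qed.
#[export] Hint Extern 1 (effective _ (fun x => seq _ _)) => apply comp_seq : cmp.

(** * Derivations *)

Notation triples := (list (nat * (nat * nat))).

Definition mem (D : triples) (c x y : nat) : bool :=
  existsb (fun d => (fst d =? c) && ((fst (snd d) =? x) && (snd (snd d) =? y))) D.

Definition just (q : nat -> nat -> bool) (D : triples) (t : nat * (nat * nat)) : bool :=
  let c := fst t in let x := fst (snd t) in let y := snd (snd t) in
  (c =? 0) && (y =? 0) || (c =? 1) && (y =? S x) ||
  (c =? 2) && (y =? fst (Cantor.of_nat x)) ||
  (c =? 3) && (y =? snd (Cantor.of_nat x)) || (c =? 4) && q x y ||
  existsb (fun z =>
    let f := fst (Cantor.of_nat z) in let g := snd (Cantor.of_nat z) in
    (c =? 5 + 4 * z) &&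
      (mem D f x (fst (Cantor.of_nat y)) && mem D g x (snd (Cantor.of_nat y))) ||
    (c =? 6 + 4 * z) &&
      existsb (fun d => (fst d =? g) && (fst (snd d) =? x) && mem D f (snd (snd d)) y) D ||
    (c =? 7 + 4 * z) &&
      (let a := fst (Cantor.of_nat x) in
       match snd (Cantor.of_nat x) with
       | 0 => mem D f a y
       | S m => existsb (fun d => (fst d =? c) && (fst (snd d) =? npair a m) &&
                  mem D g (npair a (npair m (snd (snd d)))) y) D
       end) ||
    (c =? 8 + 4 * z) &&
      (mem D z (npair x y) 0 &&
       forallb (fun m => existsb (fun d => (fst d =? z) && (fst (snd d) =? npair x m) &&
                  (0 <? snd (snd d))) D) (seq 0 y)))
    (seq 0 (S c)).

Lemma mem_In D c x y : mem D c x y = true <-> In (c, (x, y)) D.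
Proof.
  unfold mem. rewrite existsb_exists. split.
  - intros ([c' [x' y']] & I & E). cbn in E.
    rewrite !andb_true_iff, !Nat.eqb_eq in E. destruct E as (-> & -> & ->). easy.
  - intro I. exists (c, (x, y)). cbn. now rewrite !Nat.eqb_refl.
Qed.

Definition local_just (q : nat -> nat -> bool) (D : triples) (c : code) (x y : nat) : Prop :=
  match c with
  | Zero => y = 0
  | Succ => y = S x
  | Fst => y = fst (Cantor.of_nat x)
  | Snd => y = snd (Cantor.of_nat x)
  | Query => q x y = true
  | Pair f g => exists u v,
      In (encode f, (x, u)) D /\ In (encode g, (x, v)) D /\ y = npair u v
  | Comp f g => exists u, In (encode g, (x, u)) D /\ In (encode f, (u, y)) D
  | Prec f g =>
      let a := fst (Cantor.of_nat x) in
      match snd (Cantor.of_nat x) with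
      | 0 => In (encode f, (a, y)) D
      | S m => exists u, In (encode c, (npair a m, u)) D /\
          In (encode g, (npair a (npair m u), y)) D
      end
  | Mu f => In (encode f, (npair x y, 0)) D /\
      forall m, m < y -> exists k, In (encode f, (npair x m, S k)) D
  end.

Lemma just_iff q D c x y : just q D (encode c, (x, y)) = true <-> local_just q D c x y.
Proof.
  unfold just, local_just; cbn [fst snd].
  destruct c; cbn [encode];
  rewrite !orb_true_iff, !andb_true_iff, existsb_exists, ?Nat.eqb_eq.
  1-5: split; [|intros; now intuition].
  1-5: intros [[[[[[? ?]|[? ?]]|[? ?]]|[? ?]]|[? ?]]|(z & _ & H)]; try easy; exfalso;
    rewrite !orb_true_iff, !andb_true_iff, ?Nat.eqb_eq in H;
    destruct H as [[[[? _]|[? _]]|[? _]]|[? _]]; lia.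
  - split.
    + intros [[[[[[? ?]|[? ?]]|[? ?]]|[? ?]]|[? ?]]|(z & _ & H)]; try lia.
      rewrite !orb_true_iff, !andb_true_iff, ?Nat.eqb_eq, !mem_In in H.
      destruct H as [[[[E [H1 H2]]|[? _]]|[? _]]|[? _]]; try lia.
      assert (z = npair (encode c1) (encode c2)) by lia. subst z.
      rewrite of_nat_npair in *; cbn in *.
      eexists _, _. split; [eassumption|]. split; [eassumption|]. now rewrite npair_of_nat.
    + intros (u & v & H1 & H2 & ->). right. exists (npair (encode c1) (encode c2)).
      split; [apply in_seq; lia|].
      rewrite Nat.eqb_refl, !of_nat_npair; cbn [fst snd].
      apply mem_In in H1, H2. now rewrite H1, H2.
  - split.
    + intros [[[[[[? ?]|[? ?]]|[? ?]]|[? ?]]|[? ?]]|(z & _ & H)]; try lia.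
      rewrite !orb_true_iff, !andb_true_iff, ?Nat.eqb_eq, existsb_exists in H.
      destruct H as [[[[? _]|[E [[g [x' u]] [H1 H2]]]]|[? _]]|[? _]]; try lia.
      assert (z = npair (encode c1) (encode c2)) by lia. subst z.
      rewrite of_nat_npair in *; cbn in *.
      rewrite !andb_true_iff, !Nat.eqb_eq, mem_In in H2.
      destruct H2 as ((-> & ->) & H2). now exists u.
    + intros (u & H1 & H2). right. exists (npair (encode c1) (encode c2)).
      split; [apply in_seq; lia|].
      rewrite Nat.eqb_refl, !of_nat_npair; cbn [fst snd].
      rewrite !orb_true_iff. left. left. right. cbn [andb].
      rewrite existsb_exists. exists (encode c2, (x, u)). split; [easy|].
      cbn. rewrite !Nat.eqb_refl. now apply mem_In.
  - split.
    + intros [[[[[[? ?]|[? ?]]|[? ?]]|[? ?]]|[? ?]]|(z & _ & H)]; try lia.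
      rewrite !orb_true_iff, !andb_true_iff, ?Nat.eqb_eq in H.
      destruct H as [[[[? _]|[? _]]|[E H]]|[? _]]; try lia.
      assert (z = npair (encode c1) (encode c2)) by lia. subst z.
      rewrite of_nat_npair in *; cbn [fst snd] in *.
      destruct (snd (Cantor.of_nat x)) as [|m]; [now apply mem_In|].
      apply existsb_exists in H. destruct H as ([c' [x' u]] & H1 & H2).
      rewrite !andb_true_iff, !Nat.eqb_eq, mem_In in H2. cbn [fst snd] in H2.
      destruct H2 as ((-> & ->) & H2). now exists u.
    + intros H. right. exists (npair (encode c1) (encode c2)).
      split; [apply in_seq; lia|].
      rewrite Nat.eqb_refl, !of_nat_npair; cbn [fst snd].
      rewrite !orb_true_iff. left. right. cbn [andb].
      destruct (snd (Cantor.of_nat x)) as [|m]; [now apply mem_In|].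
      destruct H as (u & H1 & H2).
      rewrite existsb_exists. exists (encode (Prec c1 c2), (npair (fst (Cantor.of_nat x)) m, u)).
      split; [easy|]. cbn [fst snd encode].
      rewrite !Nat.eqb_refl. now apply mem_In.
  - split.
    + intros [[[[[[? ?]|[? ?]]|[? ?]]|[? ?]]|[? ?]]|(z & _ & H)]; try lia.
      rewrite !orb_true_iff, !andb_true_iff, ?Nat.eqb_eq in H.
      destruct H as [[[[? _]|[? _]]|[? _]]|[E [H1 H2]]]; try lia.
      assert (z = encode c) by lia. subst z. split; [now apply mem_In|].
      rewrite forallb_forall in H2. intros m Hm.
      specialize (H2 m ltac:(apply in_seq; lia)).
      apply existsb_exists in H2. destruct H2 as ([c' [x' u]] & H2 & H3).
      rewrite !andb_true_iff, !Nat.eqb_eq, Nat.ltb_lt in H3. cbn [fst snd] in H3.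
      destruct H3 as ((-> & ->) & H3). exists (pred u). now replace (S (pred u)) with u by lia.
    + intros [H1 H2]. right. exists (encode c). split; [apply in_seq; lia|].
      rewrite Nat.eqb_refl, !orb_true_iff. right. cbn [andb].
      apply andb_true_iff. split; [now apply mem_In|].
      apply forallb_forall. intros m Hm. apply in_seq in Hm.
      destruct (H2 m ltac:(lia)) as [k Hk]. apply existsb_exists.
      exists (encode c, (npair x m, S k)). split; [easy|]. cbn. now rewrite !Nat.eqb_refl.
Qed.

Lemma local_just_mono q q' D D' c x y :
  (forall x y, q x y = true -> q' x y = true) -> incl D D' ->
  local_just q D c x y -> local_just q' D' c x y.
Proof.
  intros Hq HD. destruct c; cbn; auto.
  - intros (u & v & ? & ? & ?). exists u, v. auto.
  - intros (u & ? & ?). exists u. auto.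
  - destruct (snd (Cantor.of_nat x)); auto. intros (u & ? & ?). exists u. auto.
  - intros [H1 H2]. split; auto. intros m Hm. destruct (H2 m Hm) as [k Hk]. exists k; auto.
Qed.

Definition valid (q : nat -> nat -> bool) (D : triples) : bool := forallb (just q D) D.

Lemma valid_iff q D : valid q D = true <->
  forall c x y, In (encode c, (x, y)) D -> local_just q D c x y.
Proof.
  unfold valid. rewrite forallb_forall. split.
  - intros H c x y I. apply just_iff. now apply H.
  - intros H [n [x y]] I. destruct (encode_surj n) as [c <-]. apply just_iff. now apply H.
Qed.

(** Membership in a locally justified set needs no order on the triples:
    every justification is by triples of smaller [(code, recursion depth)]. *)
Definition derives (q : nat -> nat -> bool) (D : triples) (n x y : nat) : bool :=
  valid q D && mem D n x y.

Lemma derives_sound O D c x y :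
  derives (fun u v => v =? O u) D (encode c) x y = true -> eval O c x y.
Proof.
  unfold derives. rewrite andb_true_iff, mem_In, valid_iff. intros [V I].
  revert x y I. induction c; intros x y I; pose proof (V _ _ _ I) as J; cbn in *; auto.
  - now apply Nat.eqb_eq.
  - destruct J as (u & v & ? & ? & ->). exists u, v. auto.
  - destruct J as (u & ? & ?). exists u. auto.
  - remember (snd (Cantor.of_nat x)) as n eqn:En.
    revert x y I J En. induction n as [|n IH]; intros x y I J En; cbn; auto.
    destruct J as (u & H1 & H2). exists u. split; auto.
    replace (fst (Cantor.of_nat x)) with (fst (Cantor.of_nat (npair (fst (Cantor.of_nat x)) n)))
      by now rewrite of_nat_npair.
    apply IH; [easy| |now rewrite of_nat_npair].
    specialize (V (Prec c1 c2) _ _ H1). cbn in V. now rewrite of_nat_npair in *.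
  - destruct J as [H1 H2]. split; auto.
    intros m Hm. destruct (H2 m Hm) as [k Hk]. exists k. auto.
Qed.

Lemma valid_app q D D' : valid q D = true -> valid q D' = true -> valid q (D ++ D') = true.
Proof.
  rewrite !valid_iff. intros H H' c x y I. apply in_app_or in I. destruct I as [I|I].
  - eapply local_just_mono; [| |apply H, I]; [easy|]. intros t Ht; apply in_or_app; auto.
  - eapply local_just_mono; [| |apply H', I]; [easy|]. intros t Ht; apply in_or_app; auto.
Qed.

Lemma valid_cons q D c x y :
  valid q D = true -> local_just q D c x y -> valid q ((encode c, (x, y)) :: D) = true.
Proof.
  rewrite !valid_iff. intros H J c' x' y' [E|I].
  - injection E as E -> ->. apply encode_inj in E. subst c'.
    eapply local_just_mono; [| |apply J]; [easy|]. apply incl_tl, incl_refl.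
  - eapply local_just_mono; [| |apply H, I]; [easy|]. apply incl_tl, incl_refl.
Qed.

Lemma valid_step q D c x y : valid q D = true -> local_just q D c x y ->
  exists D', valid q D' = true /\ In (encode c, (x, y)) D'.
Proof. intros V J. eexists. split; [apply valid_cons; eassumption|]. now left. Qed.

Lemma valid_union q (P : nat -> nat * (nat * nat) -> Prop) n :
  (forall m, m < n -> exists D t, valid q D = true /\ In t D /\ P m t) ->
  exists D, valid q D = true /\ forall m, m < n -> exists t, In t D /\ P m t.
Proof.
  induction n as [|n IH]; intro H; [now exists []|].
  destruct IH as (D & V & HD); [intros; apply H; lia|].
  destruct (H n ltac:(lia)) as (D' & t & V' & I & Ht).
  exists (D ++ D'). split; [now apply valid_app|]. intros m Hm.
  destruct (Nat.eq_dec m n) as [->|].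
  - exists t. split; [|easy]. apply in_or_app; now right.
  - destruct (HD m ltac:(lia)) as (t' & I' & ?). exists t'. split; [|easy].
    apply in_or_app; now left.
Qed.

Lemma derives_complete O c x y :
  eval O c x y -> exists D, derives (fun u v => v =? O u) D (encode c) x y = true.
Proof.
  enough (K : eval O c x y -> exists D, valid (fun u v => v =? O u) D = true /\
    In (encode c, (x, y)) D).
  { intro H. destruct (K H) as (D & V & I). exists D. unfold derives. rewrite V.
    now apply mem_In. }
  set (q := fun u v => v =? O u).
  assert (V0 : valid q [] = true) by easy.
  revert x y. induction c; intros x y; cbn [eval];
    try (intros ->; apply (valid_step _ [] _ _ _ V0); cbn; easy).
  - intros ->. apply (valid_step _ [] _ _ _ V0); cbn. apply Nat.eqb_refl.
  - intros (u & v & H1 & H2 & ->).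
    destruct (IHc1 _ _ H1) as (D1 & V1 & I1), (IHc2 _ _ H2) as (D2 & V2 & I2).
    apply (valid_step _ (D1 ++ D2)); [now apply valid_app|]. cbn.
    exists u, v. repeat split; apply in_or_app; auto.
  - intros (u & H2 & H1).
    destruct (IHc1 _ _ H1) as (D1 & V1 & I1), (IHc2 _ _ H2) as (D2 & V2 & I2).
    apply (valid_step _ (D1 ++ D2)); [now apply valid_app|]. cbn.
    exists u. split; apply in_or_app; auto.
  - remember (fst (Cantor.of_nat x)) as a eqn:Ea.
    remember (snd (Cantor.of_nat x)) as n eqn:En.
    assert (Ex : x = npair a n) by (subst; now rewrite npair_of_nat).
    clear Ea En. subst x. revert y. induction n as [|n IH]; intros y; cbn.
    + intro H. destruct (IHc1 _ _ H) as (D1 & V1 & I1).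
      apply (valid_step _ D1 (Prec c1 c2)); [easy|]. cbn. now rewrite of_nat_npair.
    + intros (u & H1 & H2).
      destruct (IH _ H1) as (D1 & V1 & I1), (IHc2 _ _ H2) as (D2 & V2 & I2).
      apply (valid_step _ (D1 ++ D2) (Prec c1 c2)); [now apply valid_app|]. cbn.
      rewrite of_nat_npair. cbn. exists u. split; apply in_or_app; auto.
  - intros [H1 H2]. destruct (IHc _ _ H1) as (D1 & V1 & I1).
    destruct (valid_union q (fun m t => exists k, t = (encode c, (npair x m, S k))) y)
      as (D2 & V2 & I2).
    { intros m Hm. destruct (H2 m Hm) as [k Hk]. destruct (IHc _ _ Hk) as (D & V & I).
      exists D. eexists. split; [easy|]. split; [apply I|]. now exists k. }
    apply (valid_step _ (D1 ++ D2)); [now apply valid_app|]. cbn. split.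
    + apply in_or_app; now left.
    + intros m Hm. destruct (I2 m Hm) as (t & I & k & ->). exists k.
      apply in_or_app; now right.
Qed.

Lemma phi_derives O n x y :
  phi O n x y <-> exists D, derives (fun u v => v =? O u) D n x y = true.
Proof.
  split.
  - intros (c & <- & H). now apply derives_complete.
  - intros [D H]. destruct (encode_surj n) as [c <-]. exists c. split; [easy|].
    now apply (derives_sound O D).
Qed.

Lemma phi_functional O n x y z : phi O n x y -> phi O n x z -> y = z.
Proof.
  intros (c & E & H) (c' & E' & H'). assert (c' = c) as -> by (apply encode_inj; lia).
  eapply eval_functional; eassumption.
Qed.

Lemma comp_mem {O A} `{Enc A} (D : A -> triples) (c x y : A -> nat) :
  effective O D -> effective O c -> effective O x -> effective O y ->
  effective O (fun a => mem (D a) (c a) (x a) (y a)).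
Proof. intros HD Hc Hx Hy. unfold mem. cmp. Qed.
#[export] Hint Extern 1 (effective _ (fun x => mem _ _ _ _)) => apply comp_mem : cmp.

Lemma comp_derives {O A} `{Enc A} (q : A -> nat -> nat -> bool) (D : A -> triples)
  (c x y : A -> nat) :
  effective O (fun p : A * (nat * nat) => q (fst p) (fst (snd p)) (snd (snd p))) ->
  effective O D -> effective O c -> effective O x -> effective O y ->
  effective O (fun a => derives (q a) (D a) (c a) (x a) (y a)).
Proof.
  intros Hq HD Hc Hx Hy. unfold derives, valid, just. cbv zeta.
  assert (Hq' : effective O (fun p : A * (nat * (nat * nat)) =>
    q (fst p) (fst (snd (snd p))) (snd (snd (snd p))))).
  { apply (comp_app3 q); cmp. }
  cmp.
Qed.
#[export] Hint Extern 1 (effective _ (fun x => derives _ _ _ _ _)) => apply comp_derives : cmp.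

(** * Search, parameters and the jump *)

Lemma least_witness (p : nat -> bool) n :
  p n = true -> exists m, p m = true /\ forall k, k < m -> p k = false.
Proof.
  induction n as [n IH] using lt_wf_ind. intro Hn.
  destruct (existsb p (seq 0 n)) eqn:E.
  - apply existsb_exists in E. destruct E as (m & I & Hm). apply in_seq in I.
    apply (IH m); [lia|easy].
  - exists n. split; [easy|]. intros k Hk. destruct (p k) eqn:Ek; [|easy].
    rewrite <- E. symmetry. apply existsb_exists. exists k. split; [|easy].
    apply in_seq. lia.
Qed.

Lemma search_code {O A B W} `{Enc A} `{Enc B} `{Onto W} (chk : A -> W -> bool) (out : A -> W -> B) :
  effective O (fun p : A * W => chk (fst p) (snd p)) ->
  effective O (fun p : A * W => out (fst p) (snd p)) ->
  exists c, forall a,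
    (forall w, chk a w = true ->
       exists w', chk a w' = true /\ eval O c (enc a) (enc (out a w'))) /\
    (forall y, eval O c (enc a) y -> exists w, chk a w = true).
Proof.
  intros Hchk Hout.
  assert (Hc : effective O (fun p : A * nat => negb (chk (fst p) (dec (snd p))))).
  { apply comp_negb, (comp_app2 chk); [easy|cmp..]. }
  assert (Ho : effective O (fun p : A * nat => out (fst p) (dec (snd p)))).
  { apply (comp_app2 out); [easy|cmp..]. }
  destruct Hc as [d Hd], Ho as [o Ho].
  assert (Hz : forall a n, eval O d (npair (enc a) n) (Nat.b2n (negb (chk a (dec n))))).
  { intros a n. apply (Hd (a, n)). }
  exists (Comp o (Pair id_code (Mu d))). intro a. split.
  - intros w Hw. destruct (least_witness (fun n => chk a (dec n)) (enc w)) as (m & Hm & Hlt).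
    { now rewrite dec_enc. }
    exists (dec m). split; [easy|]. exists (npair (enc a) m). split.
    + exists (enc a), m. split; [apply eval_id_code|]. split; [|easy]. split.
      * specialize (Hz a m). now rewrite Hm in Hz.
      * intros k Hk. exists 0. specialize (Hz a k). now rewrite (Hlt k Hk) in Hz.
    + apply (Ho (a, m)).
  - intros y (u & (u1 & m & E1 & [E2 _] & _) & _). exists (dec m).
    pose proof (eval_functional _ _ _ _ _ E2 (Hz a m)) as E.
    now destruct (chk a (dec m)).
Qed.

Definition smn (c p : nat) : nat :=
  6 + 4 * npair c (5 + 4 * npair (encode id_code) (encode (const_code p))).

Lemma phi_smn O c p x y : phi O (smn (encode c) p) x y <-> eval O c (npair x p) y.
Proof.
  change (smn (encode c) p) with (encode (Comp c (Pair id_code (const_code p)))).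
  split.
  - intros (c' & E & H). apply encode_inj in E. subst c'.
    destruct H as (u & (u1 & u2 & H1 & H2 & ->) & H).
    rewrite (eval_functional _ _ _ _ _ H1 (eval_id_code O x)) in H.
    now rewrite (eval_functional _ _ _ _ _ H2 (eval_const_code O p x)) in H.
  - intro H. eexists; split; [reflexivity|]. exists (npair x p). split; [|easy].
    exists x, p. split; [apply eval_id_code|]. split; [apply eval_const_code|easy].
Qed.

Lemma comp_smn {O A} `{Enc A} (c : nat) (p : A -> nat) :
  effective O p -> effective O (fun x => smn c (p x)).
Proof.
  intro Hp. unfold smn.
  assert (K : effective O (fun x => encode (const_code (p x)))).
  { apply (comp_ext (fun x => nat_rect (fun _ => nat) 0 (fun _ u => 6 + 4 * npair 1 u) (p x))).
    { intro x. induction (p x) as [|n IH]; cbn [nat_rect const_code encode]; now rewrite ?IH. }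
    apply (comp_nat_rect (fun _ => 0) (fun _ _ u => 6 + 4 * npair 1 u)); cmp. }
  cmp.
Qed.
#[export] Hint Extern 1 (effective _ (fun x => smn _ _)) => apply comp_smn : cmp.

Lemma jump_decides {A W} `{Enc A} `{Onto W} (chk : A -> W -> bool) :
  effective (char empty) (fun p : A * W => chk (fst p) (snd p)) ->
  exists d : A -> bool, effective (char (jump empty)) d /\
    forall a, d a = true <-> exists w, chk a w = true.
Proof.
  intro Hchk.
  destruct (search_code (O := char empty) (fun p : nat * A => chk (snd p)) (fun _ _ => 0)) as [c Hc];
    [apply (comp_app2 chk); [easy|cmp..]|cmp|].
  exists (fun a => negb (char (jump empty) (smn (encode c) (enc a)) =? 0)). split.
  - apply comp_negb, comp_eq0, comp_query. cmp.
  - intro a. unfold char, jump.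
    destruct excluded_middle_informative as [[y Hy]|N]; cbn; split; try easy.
    + intros _. apply phi_smn in Hy.
      apply (proj2 (Hc (smn (encode c) (enc a), a)) y Hy).
    + intros [w Hw]. destruct N.
      destruct (proj1 (Hc (smn (encode c) (enc a), a)) w Hw) as (w' & _ & E).
      eexists. apply phi_smn, E.
Qed.

(** Oracle answers read off a finite initial segment; [S] shifts the entries so
    that the default [0] of [nth] means no answer. *)
Definition ask (s : list nat) (u v : nat) : bool := nth u (map S s) 0 =? S v.

Definition sphi (s : list nat) (n x y : nat) : Prop :=
  exists D, derives (ask s) D n x y = true.

Definition prefix_of (f : nat -> nat) (n : nat) : list nat := map f (seq 0 n).

Lemma ask_app s t u v : ask s u v = true -> ask (s ++ t) u v = true.
Proof.
  unfold ask. rewrite !Nat.eqb_eq, map_app. intro E.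
  rewrite app_nth1; [easy|]. destruct (le_lt_dec (length (map S s)) u); [|easy].
  rewrite nth_overflow in E by easy. lia.
Qed.

Lemma ask_prefix f n u v : ask (prefix_of f n) u v = true <-> u < n /\ v = f u.
Proof.
  unfold ask, prefix_of. rewrite map_map, Nat.eqb_eq. destruct (le_lt_dec n u).
  - rewrite nth_overflow by (rewrite length_map, length_seq; lia). lia.
  - rewrite nth_indep with (d' := S (f 0)) by (rewrite length_map, length_seq; lia).
    rewrite (map_nth (fun x => S (f x))), seq_nth by easy. cbn. lia.
Qed.

Lemma derives_mono q q' D n x y :
  (forall c u v, In (c, (u, v)) D -> q u v = true -> q' u v = true) ->
  derives q D n x y = true -> derives q' D n x y = true.
Proof.
  unfold derives. rewrite !andb_true_iff, !valid_iff. intros Hq [V M]. split; [|easy].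
  intros c u v I. specialize (V c u v I). destruct c; try easy. cbn in *. eauto.
Qed.

Lemma sphi_app s t n x y : sphi s n x y -> sphi (s ++ t) n x y.
Proof.
  intros [D H]. exists D. eapply derives_mono; [|apply H]. intros. now apply ask_app.
Qed.

Lemma sphi_phi f n m x y : sphi (prefix_of f n) m x y -> phi f m x y.
Proof.
  intros [D H]. apply phi_derives. exists D. eapply derives_mono; [|apply H].
  intros c u v _ E. apply ask_prefix in E. now apply Nat.eqb_eq.
Qed.

Lemma phi_sphi f m x y : phi f m x y -> exists n, sphi (prefix_of f n) m x y.
Proof.
  intro H. apply phi_derives in H. destruct H as [D H].
  exists (S (list_max (map (fun t => fst (snd t)) D))). exists D.
  eapply derives_mono; [|apply H]. intros c u v I E.
  apply ask_prefix. apply Nat.eqb_eq in E. split; [|easy].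
  apply Nat.lt_succ_r.
  pose proof (proj1 (list_max_le (map (fun t => fst (snd t)) D) _) (le_n _)) as F.
  rewrite Forall_forall in F. apply F. apply in_map_iff. now exists (c, (u, v)).
Qed.

Lemma prefix_of_app f n m : n <= m -> exists t, prefix_of f m = prefix_of f n ++ t.
Proof.
  intro L. unfold prefix_of. exists (map f (seq n (m - n))).
  rewrite <- map_app. replace m with (n + (m - n)) at 1 by lia. now rewrite seq_app.
Qed.

Lemma comp_ask {O A} `{Enc A} (s : A -> list nat) (u v : A -> nat) :
  effective O s -> effective O u -> effective O v -> effective O (fun a => ask (s a) (u a) (v a)).
Proof. intros. unfold ask. cmp. Qed.
#[export] Hint Extern 1 (effective _ (fun x => ask _ _ _)) => apply comp_ask : cmp.

(** * Bushy trees *)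

Inductive big (j : nat) (A : list nat -> Prop) : list nat -> Prop :=
| big_leaf s : A s -> big j A s
| big_node s D : NoDup D -> 2 ^ (j * S (length s)) <= length D ->
    (forall v, In v D -> big j A (s ++ [v])) -> big j A s.

Lemma pow2_pos n : 0 < 2 ^ n.
Proof. apply Nat.neq_0_lt_0, Nat.pow_nonzero. lia. Qed.

Definition decide (P : Prop) : bool :=
  if excluded_middle_informative P then true else false.

Lemma decide_iff P : decide P = true <-> P.
Proof. unfold decide. now destruct excluded_middle_informative. Qed.

Lemma filter_partition_length {A} (f : A -> bool) l :
  length (filter f l) + length (filter (fun x => negb (f x)) l) = length l.
Proof. induction l as [|x l IH]; cbn; [easy|]. destruct (f x); cbn; lia. Qed.

Lemma pigeonhole (P : nat -> nat -> Prop) H m D :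
  NoDup D -> 0 < length D -> 0 < m -> H * m <= length D ->
  (forall d, In d D -> exists v, v < H /\ P v d) ->
  exists v D', v < H /\ NoDup D' /\ m <= length D' /\ forall d, In d D' -> P v d.
Proof.
  revert D. induction H as [|H IH]; intros D ND L0 Hm L HD.
  - destruct D as [|d D]; [cbn in L0; lia|].
    destruct (HD d ltac:(now left)) as (v & ? & _). lia.
  - pose proof (filter_partition_length (fun d => decide (P H d)) D) as E.
    destruct (le_lt_dec m (length (filter (fun d => decide (P H d)) D))) as [G|G].
    + exists H, (filter (fun d => decide (P H d)) D).
      split; [lia|]. split; [now apply NoDup_filter|]. split; [easy|].
      intros d I. apply filter_In in I. now apply decide_iff.
    + destruct (IH (filter (fun d => negb (decide (P H d))) D)) as (v & D' & ? & ? & ? & ?).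
      * now apply NoDup_filter.
      * lia.
      * easy.
      * lia.
      * intros d I. apply filter_In in I. destruct I as [I N].
        destruct (HD d I) as (v & Lv & Hv). exists v. split; [|easy].
        destruct (Nat.eq_dec v H) as [->|]; [|lia].
        apply decide_iff in Hv. now rewrite Hv in N.
      * exists v, D'. repeat split; auto with arith.
Qed.

Lemma big_pigeonhole j H (A : nat -> list nat -> Prop) s :
  big (j + H) (fun t => exists v, v < H /\ A v t) s ->
  exists v, v < H /\ big j (A v) s.
Proof.
  induction 1 as [s (v & L & Hv)|s D ND L _ IH].
  { exists v. split; [easy|]. now apply big_leaf. }
  destruct (pigeonhole (fun v d => big j (A v) (s ++ [d])) H (2 ^ (j * S (length s))) D)
    as (v & D' & Lv & ND' & L' & HD').
  - easy.
  - pose proof (pow2_pos ((j + H) * S (length s))). lia.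
  - apply pow2_pos.
  - etransitivity; [|apply L].
    replace ((j + H) * S (length s)) with (H * S (length s) + j * S (length s)) by ring.
    rewrite Nat.pow_add_r. apply Nat.mul_le_mono_r.
    etransitivity; [apply Nat.lt_le_incl, (Nat.pow_gt_lin_r 2); lia|].
    apply Nat.pow_le_mono_r; lia.
  - easy.
  - exists v. split; [easy|]. now apply (big_node _ _ _ D').
Qed.

Lemma big_ext j A B s : (forall t, A t -> B t) -> big j A s -> big j B s.
Proof.
  intro E. induction 1 as [s Hs|s D ND L _ IH].
  - now apply big_leaf, E.
  - now apply (big_node _ _ _ D).
Qed.

Notation plan := (nat * list (list nat))%type.

Definition inb (t : list nat) (B : list (list nat)) : bool :=
  existsb (fun u => enc t =? enc u) B.

Definition kids (p : plan) (t : list nat) : list nat :=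
  filter (fun v => inb (t ++ [v]) (snd p)) (seq 0 (fst p)).

Definition bushy (j : nat) (p : plan) (t : list nat) : bool :=
  2 ^ (j * S (length t)) <=? length (kids p t).

Definition leafb (a e : nat) (vs : list nat) (DD : list triples) (t : list nat) : bool :=
  existsb (fun v => existsb (fun D => derives (ask t) D a e v) DD) vs.

Definition bigb (a e : nat) (vs : list nat) (j : nat) (s : list nat)
    (w : plan * list triples) : bool :=
  inb s (snd (fst w)) &&
  forallb (fun t => leafb a e vs (snd w) t || bushy j (fst w) t) (snd (fst w)).

Lemma inb_In t B : inb t B = true <-> In t B.
Proof.
  unfold inb. rewrite existsb_exists. split.
  - intros (u & I & E). apply Nat.eqb_eq, enc_inj in E. now subst.
  - intro I. exists t. split; [easy|]. apply Nat.eqb_refl.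
Qed.

Lemma kids_In p t v : In v (kids p t) <-> v < fst p /\ In (t ++ [v]) (snd p).
Proof. unfold kids. rewrite filter_In, inb_In, in_seq. intuition lia. Qed.

Lemma kids_NoDup p t : NoDup (kids p t).
Proof. apply NoDup_filter, seq_NoDup. Qed.

Lemma leafb_sphi a e vs DD t :
  leafb a e vs DD t = true -> exists v, In v vs /\ sphi t a e v.
Proof.
  unfold leafb. intro H. apply existsb_exists in H. destruct H as (v & I & H).
  apply existsb_exists in H. destruct H as (D & _ & H). exists v. split; [easy|]. now exists D.
Qed.

Definition max_length (B : list (list nat)) : nat := list_max (map (@length nat) B).

Lemma max_length_In t B : In t B -> length t <= max_length B.
Proof.
  intro I. pose proof (proj1 (list_max_le (map (@length nat) B) _) (le_n _)) as F.
  rewrite Forall_forall in F. apply F. now apply in_map.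
Qed.

Lemma bigb_big a e vs j s w : bigb a e vs j s w = true ->
  big j (fun t => exists v, In v vs /\ sphi t a e v) s.
Proof.
  unfold bigb. rewrite andb_true_iff, forallb_forall, inb_In.
  intros [I H]. remember (max_length (snd (fst w)) - length s) as k eqn:Ek.
  revert s I Ek. induction k as [k IH] using lt_wf_ind; intros s I Ek.
  pose proof (H s I) as Hs. apply orb_true_iff in Hs. destruct Hs as [Hs|Hs].
  - apply big_leaf. now apply leafb_sphi in Hs.
  - apply (big_node _ _ _ (kids (fst w) s)).
    + apply kids_NoDup.
    + now apply Nat.leb_le.
    + intros v Hv. apply kids_In in Hv. destruct Hv as [_ Hv].
      pose proof (max_length_In _ _ Hv) as L. rewrite length_app in L. cbn in L.
      apply (IH (max_length (snd (fst w)) - length (s ++ [v]))); [|easy|easy].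
      rewrite length_app. cbn. lia.
Qed.

Lemma leafb_incl a e vs DD DD' t : incl DD DD' ->
  leafb a e vs DD t = true -> leafb a e vs DD' t = true.
Proof.
  unfold leafb. intros I H. apply existsb_exists in H. destruct H as (v & Iv & H).
  apply existsb_exists in H. destruct H as (D & ID & H). apply existsb_exists.
  exists v. split; [easy|]. apply existsb_exists. exists D. auto.
Qed.

Lemma bushy_incl j N N' B B' t : N <= N' -> incl B B' ->
  bushy j (N, B) t = true -> bushy j (N', B') t = true.
Proof.
  unfold bushy. rewrite !Nat.leb_le. intros LN I L. etransitivity; [apply L|].
  apply NoDup_incl_length; [apply kids_NoDup|]. intros v Hv. apply kids_In in Hv.
  apply kids_In. cbn in *. split; [lia|]. now apply I.
Qed.

Definition closed_plan a e vs j (w : plan * list triples) : Prop :=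
  forall t, In t (snd (fst w)) -> leafb a e vs (snd w) t || bushy j (fst w) t = true.

Lemma bigb_iff_closed a e vs j s w : bigb a e vs j s w = true <->
  In s (snd (fst w)) /\ closed_plan a e vs j w.
Proof. unfold bigb. now rewrite andb_true_iff, forallb_forall, inb_In. Qed.

Lemma closed_plan_incl a e vs j N N' B B' DD DD' t :
  N <= N' -> incl B B' -> incl DD DD' ->
  leafb a e vs DD t || bushy j (N, B) t = true ->
  leafb a e vs DD' t || bushy j (N', B') t = true.
Proof.
  intros LN IB ID. rewrite !orb_true_iff. intros [H|H].
  - left. eapply leafb_incl; eassumption.
  - right. eapply bushy_incl; eassumption.
Qed.

Lemma closed_plan_union a e vs j (D : list nat) s :
  (forall v, In v D -> exists w, bigb a e vs j (s ++ [v]) w = true) ->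
  exists w, closed_plan a e vs j w /\ forall v, In v D -> v < fst (fst w) /\ In (s ++ [v]) (snd (fst w)).
Proof.
  induction D as [|v D IH]; intro H.
  - exists ((0, []), []). split; easy.
  - destruct IH as ([[N B] DD] & C & HD); [intros; apply H; now right|].
    destruct (H v ltac:(now left)) as ([[N' B'] DD'] & H').
    apply bigb_iff_closed in H'. destruct H' as [I' C']. cbn in *.
    exists ((S v + N + N', B ++ B'), DD ++ DD'). split; cbn.
    + intros t It. cbn in *. apply in_app_or in It. destruct It as [It|It].
      * eapply closed_plan_incl; [..|apply (C t It)]; [lia|now apply incl_appl, incl_refl..].
      * eapply closed_plan_incl; [..|apply (C' t It)]; [lia|now apply incl_appr, incl_refl..].
    + intros u [->|Hu].
      * split; [lia|]. apply in_or_app. now right.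
      * destruct (HD u Hu). split; [lia|]. apply in_or_app. now left.
Qed.

Lemma big_bigb a e vs j s : big j (fun t => exists v, In v vs /\ sphi t a e v) s ->
  exists w, bigb a e vs j s w = true.
Proof.
  induction 1 as [s (v & Iv & D & HD)|s D ND L _ IH].
  - exists ((0, [s]), [D]). apply bigb_iff_closed. split; cbn; [now left|].
    intros t [<-|[]]. apply orb_true_iff. left. apply existsb_exists. exists v.
    split; [easy|]. cbn. now rewrite HD.
  - destruct (closed_plan_union a e vs j D s IH) as ([[N B] DD] & C & HD).
    exists ((N, s :: B), DD). apply bigb_iff_closed. split; cbn; [now left|].
    intros t [<-|It]; cbn.
    + apply orb_true_iff. right. apply Nat.leb_le. etransitivity; [apply L|].
      apply NoDup_incl_length; [easy|]. intros v Hv. apply kids_In. cbn.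
      destruct (HD v Hv). auto.
    + eapply closed_plan_incl; [..|apply (C t It)]; [easy|now apply incl_tl, incl_refl|apply incl_refl].
Qed.

Lemma comp_inb {O A} `{Enc A} (t : A -> list nat) (B : A -> list (list nat)) :
  effective O t -> effective O B -> effective O (fun a => inb (t a) (B a)).
Proof. intros. unfold inb. cmp. Qed.
#[export] Hint Extern 1 (effective _ (fun x => inb _ _)) => apply comp_inb : cmp.

Lemma comp_kids {O A} `{Enc A} (p : A -> plan) (t : A -> list nat) :
  effective O p -> effective O t -> effective O (fun a => kids (p a) (t a)).
Proof. intros. unfold kids. cmp. Qed.
#[export] Hint Extern 1 (effective _ (fun x => kids _ _)) => apply comp_kids : cmp.

Lemma comp_bushy {O A} `{Enc A} (j : A -> nat) (p : A -> plan) (t : A -> list nat) :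
  effective O j -> effective O p -> effective O t -> effective O (fun a => bushy (j a) (p a) (t a)).
Proof. intros. unfold bushy. cmp. Qed.
#[export] Hint Extern 1 (effective _ (fun x => bushy _ _ _)) => apply comp_bushy : cmp.

Lemma comp_bigb {O A} `{Enc A} (a e : A -> nat) (vs : A -> list nat) (j : A -> nat)
  (s : A -> list nat) (w : A -> plan * list triples) :
  effective O a -> effective O e -> effective O vs -> effective O j -> effective O s -> effective O w ->
  effective O (fun x => bigb (a x) (e x) (vs x) (j x) (s x) (w x)).
Proof. intros. unfold bigb, leafb. cmp. Qed.
#[export] Hint Extern 1 (effective _ (fun x => bigb _ _ _ _ _ _)) => apply comp_bigb : cmp.

Lemma diagonal_search_code : exists c, forall a s j e,
  (forall v, big j (fun t => sphi t a e v) s ->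
     exists v', big j (fun t => sphi t a e v') s /\
       eval (char empty) c (npair e (enc (a, (s, j)))) v').
Proof.
  destruct (search_code (O := char empty)
    (fun (p : nat * (nat * (list nat * nat))) (w : nat * (plan * list triples)) =>
       bigb (fst (snd p)) (fst p) [fst w] (snd (snd (snd p))) (fst (snd (snd p))) (snd w))
    (fun _ w => fst w)) as [c Hc]; [cmp..|].
  exists c. intros a s j e v Hv.
  destruct (big_bigb a e [v] j s) as [w Hw].
  { eapply big_ext; [|apply Hv]. intros t Ht. exists v. split; [now left|easy]. }
  destruct (proj1 (Hc (e, (a, (s, j)))) (v, w) Hw) as ([v' w'] & Hw' & E).
  exists v'. split; [|exact E]. cbn in Hw'. apply bigb_big in Hw'.
  eapply big_ext; [|apply Hw']. now intros t (u & [<-|[]] & Hu).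
Qed.

(** Diagonal evaluation [phi_e(e)] supplies the index [e] to its own program, so
    no recursion theorem is needed. *)
Definition target (a : nat) (s : list nat) (j : nat) : nat :=
  smn (encode (proj1_sig (constructive_indefinite_description _ diagonal_search_code)))
    (enc (a, (s, j))).

Definition hit (a e j : nat) (s : list nat) : Prop :=
  exists v, phi (char empty) e e v /\ big j (fun t => sphi t a e v) s.

Lemma target_hit a s j v :
  big j (fun t => sphi t a (target a s j) v) s -> hit a (target a s j) j s.
Proof.
  intro H. unfold target in *.
  destruct constructive_indefinite_description as [c Hc]; cbn in *.
  destruct (Hc a s j _ v H) as (v' & Hv' & E). exists v'. split; [|easy].
  apply phi_smn, E.
Qed.

Lemma comp_target {O A} `{Enc A} (a : A -> nat) (s : A -> list nat) (j : A -> nat) :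
  effective O a -> effective O s -> effective O j -> effective O (fun x => target (a x) (s x) (j x)).
Proof. intros. unfold target. cmp. Qed.
#[export] Hint Extern 1 (effective _ (fun x => target _ _ _)) => apply comp_target : cmp.

(** The spare component of a certificate lets every certificate recur at
    arbitrarily large numbers. *)
Definition halt_cert (x : nat) : nat * (triples * nat) := dec x.

Definition halts_by (b e x : nat) : bool :=
  derives (fun _ v => v =? 0) (fst (snd (halt_cert x))) b e (fst (halt_cert x)).

Definition hit_cert (x : nat) : nat * (triples * ((plan * list triples) * nat)) := dec x.

Definition hit_by (a e j : nat) (s : list nat) (x : nat) : bool :=
  let w := hit_cert x in
  derives (fun _ v => v =? 0) (fst (snd w)) e e (fst w) &&
  bigb a e [fst w] j s (fst (snd (snd w))).

Definition halts (b e : nat) : Prop := exists v, phi (char empty) b e v.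

Lemma halts_by_phi b e x : halts_by b e x = true -> phi (char empty) b e (fst (halt_cert x)).
Proof. intro H. apply phi_derives. eexists. apply H. Qed.

Lemma halts_halts_by b e x0 : halts b e -> exists x, x0 <= x /\ halts_by b e x = true.
Proof.
  intros [v H]. apply phi_derives in H. destruct H as [D H].
  exists (enc (v, (D, x0))). split.
  - cbn. etransitivity; [|apply npair_le_r]. apply npair_le_r.
  - unfold halts_by, halt_cert. rewrite dec_enc. exact H.
Qed.

Lemma hit_by_spec a e j s x : hit_by a e j s x = true ->
  phi (char empty) e e (fst (hit_cert x)) /\
  bigb a e [fst (hit_cert x)] j s (fst (snd (snd (hit_cert x)))) = true.
Proof.
  unfold hit_by. rewrite andb_true_iff. intros [H1 H2]. split; [|easy].
  apply phi_derives. eexists. apply H1.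
Qed.

Lemma big_singleton a e v j s :
  big j (fun t => exists u, In u [v] /\ sphi t a e u) s -> big j (fun t => sphi t a e v) s.
Proof. apply big_ext. now intros t (u & [<-|[]] & Hu). Qed.

Lemma hit_by_hit a e j s x : hit_by a e j s x = true -> hit a e j s.
Proof.
  intro H. apply hit_by_spec in H. destruct H as [H1 H2].
  eexists; split; [apply H1|]. apply big_singleton. eapply bigb_big, H2.
Qed.

Lemma hit_hit_by a e j s x0 : hit a e j s -> exists x, x0 <= x /\ hit_by a e j s x = true.
Proof.
  intros (v & H1 & H2). apply phi_derives in H1. destruct H1 as [D H1].
  destruct (big_bigb a e [v] j s) as [w Hw].
  { eapply big_ext; [|apply H2]. intros t Ht. exists v. split; [now left|easy]. }
  exists (enc (v, (D, (w, x0)))). split.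
  - cbn [enc enc_prod fst snd]. do 2 (etransitivity; [|apply npair_le_r]). apply npair_le_r.
  - unfold hit_by, hit_cert. rewrite dec_enc. cbv zeta. cbn [fst snd].
    apply andb_true_iff. split; [exact H1|exact Hw].
Qed.

Lemma comp_halts_by {O A} `{Enc A} (b e x : A -> nat) :
  effective O b -> effective O e -> effective O x -> effective O (fun a => halts_by (b a) (e a) (x a)).
Proof. intros. unfold halts_by, halt_cert. cmp. Qed.
#[export] Hint Extern 1 (effective _ (fun x => halts_by _ _ _)) => apply comp_halts_by : cmp.

Lemma comp_hit_by {O A} `{Enc A} (a e j : A -> nat) (s : A -> list nat) (x : A -> nat) :
  effective O a -> effective O e -> effective O j -> effective O s -> effective O x ->
  effective O (fun y => hit_by (a y) (e y) (j y) (s y) (x y)).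
Proof. intros. unfold hit_by, hit_cert. cbv zeta. cmp. Qed.
#[export] Hint Extern 1 (effective _ (fun x => hit_by _ _ _ _ _)) => apply comp_hit_by : cmp.

(** * The process *)

(** Phases of a requirement: 0 undecided, 1 assuming that [h(e)] diverges,
    2 assuming that no value is hit, 3 met by a hit. *)
Record status := Status {
  tries : nat; phase : nat; prog : nat;
  at_stem : list nat; at_width : nat; cap : nat }.

(** [wait] is [(0, _)] when idle, [(1, (i, x))] while waiting for [h(e)] and
    [(2, (i, x))] while waiting for a hit, [x] being the next certificate. *)
Record core := Core {
  stem : list nat; width : nat; clock : nat; path : plan;
  wait : nat * (nat * nat); log : list (nat * status) }.

#[export, refine] Instance enc_status : Enc status := {|
  enc s := enc (tries s, (phase s, (prog s, (at_stem s, (at_width s, cap s)))));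
  dec n := let '(t, (p, (e, (u, (w, h))))) := dec n in Status t p e u w h |}.
Proof. intros []. now rewrite dec_enc. Defined.

#[export, refine] Instance enc_core : Enc core := {|
  enc c := enc (stem c, (width c, (clock c, (path c, (wait c, log c)))));
  dec n := let '(u, (w, (m, (p, (x, l))))) := dec n in Core u w m p x l |}.
Proof. intros []. now rewrite dec_enc. Defined.

Section Fields.
Context {O : nat -> nat} {A : Type} `{Enc A}.

Lemma comp_status (f : A -> status) : effective O f ->
  effective O (fun x => (tries (f x), (phase (f x), (prog (f x),
    (at_stem (f x), (at_width (f x), cap (f x))))))).
Proof. intros [c Hc]. now exists c. Qed.

Lemma comp_Status (t p e : A -> nat) (u : A -> list nat) (w h : A -> nat) :
  effective O t -> effective O p -> effective O e -> effective O u -> effective O w -> effective O h ->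
  effective O (fun x => Status (t x) (p x) (e x) (u x) (w x) (h x)).
Proof.
  intros. apply (comp_recode (fun x => enc (t x, (p x, (e x, (u x, (w x, h x))))))); [easy|cmp].
Qed.

Lemma comp_tries (f : A -> status) : effective O f -> effective O (fun x => tries (f x)).
Proof. intro Hf. exact (comp_fst _ (comp_status f Hf)). Qed.

Lemma comp_phase (f : A -> status) : effective O f -> effective O (fun x => phase (f x)).
Proof. intro Hf. exact (comp_fst _ (comp_snd _ (comp_status f Hf))). Qed.

Lemma comp_prog (f : A -> status) : effective O f -> effective O (fun x => prog (f x)).
Proof. intro Hf. exact (comp_fst _ (comp_snd _ (comp_snd _ (comp_status f Hf)))). Qed.

Lemma comp_at_stem (f : A -> status) : effective O f -> effective O (fun x => at_stem (f x)).
Proof.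
  intro Hf. exact (comp_fst _ (comp_snd _ (comp_snd _ (comp_snd _ (comp_status f Hf))))).
Qed.

Lemma comp_at_width (f : A -> status) : effective O f -> effective O (fun x => at_width (f x)).
Proof.
  intro Hf.
  exact (comp_fst _ (comp_snd _ (comp_snd _ (comp_snd _ (comp_snd _ (comp_status f Hf)))))).
Qed.

Lemma comp_cap (f : A -> status) : effective O f -> effective O (fun x => cap (f x)).
Proof.
  intro Hf.
  exact (comp_snd _ (comp_snd _ (comp_snd _ (comp_snd _ (comp_snd _ (comp_status f Hf)))))).
Qed.

Lemma comp_core (f : A -> core) : effective O f ->
  effective O (fun x => (stem (f x), (width (f x), (clock (f x),
    (path (f x), (wait (f x), log (f x))))))).
Proof. intros [c Hc]. now exists c. Qed.

Lemma comp_Core (u : A -> list nat) (w m : A -> nat) (p : A -> plan)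
  (x : A -> nat * (nat * nat)) (l : A -> list (nat * status)) :
  effective O u -> effective O w -> effective O m -> effective O p -> effective O x -> effective O l ->
  effective O (fun a => Core (u a) (w a) (m a) (p a) (x a) (l a)).
Proof.
  intros. apply (comp_recode (fun a => enc (u a, (w a, (m a, (p a, (x a, l a))))))); [easy|cmp].
Qed.

Lemma comp_stem (f : A -> core) : effective O f -> effective O (fun x => stem (f x)).
Proof. intro Hf. exact (comp_fst _ (comp_core f Hf)). Qed.

Lemma comp_width (f : A -> core) : effective O f -> effective O (fun x => width (f x)).
Proof. intro Hf. exact (comp_fst _ (comp_snd _ (comp_core f Hf))). Qed.

Lemma comp_clock (f : A -> core) : effective O f -> effective O (fun x => clock (f x)).
Proof. intro Hf. exact (comp_fst _ (comp_snd _ (comp_snd _ (comp_core f Hf)))). Qed.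

Lemma comp_path (f : A -> core) : effective O f -> effective O (fun x => path (f x)).
Proof. intro Hf. exact (comp_fst _ (comp_snd _ (comp_snd _ (comp_snd _ (comp_core f Hf))))). Qed.

Lemma comp_wait (f : A -> core) : effective O f -> effective O (fun x => wait (f x)).
Proof.
  intro Hf.
  exact (comp_fst _ (comp_snd _ (comp_snd _ (comp_snd _ (comp_snd _ (comp_core f Hf)))))).
Qed.

Lemma comp_log (f : A -> core) : effective O f -> effective O (fun x => log (f x)).
Proof.
  intro Hf.
  exact (comp_snd _ (comp_snd _ (comp_snd _ (comp_snd _ (comp_snd _ (comp_core f Hf)))))).
Qed.
End Fields.

#[export] Hint Extern 1 (effective _ (fun x => Status _ _ _ _ _ _)) => apply comp_Status : cmp.
#[export] Hint Extern 1 (effective _ (fun x => tries _)) => apply comp_tries : cmp.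
#[export] Hint Extern 1 (effective _ (fun x => phase _)) => apply comp_phase : cmp.
#[export] Hint Extern 1 (effective _ (fun x => prog _)) => apply comp_prog : cmp.
#[export] Hint Extern 1 (effective _ (fun x => at_stem _)) => apply comp_at_stem : cmp.
#[export] Hint Extern 1 (effective _ (fun x => at_width _)) => apply comp_at_width : cmp.
#[export] Hint Extern 1 (effective _ (fun x => cap _)) => apply comp_cap : cmp.
#[export] Hint Extern 1 (effective _ (fun x => Core _ _ _ _ _ _)) => apply comp_Core : cmp.
#[export] Hint Extern 1 (effective _ (fun x => stem _)) => apply comp_stem : cmp.
#[export] Hint Extern 1 (effective _ (fun x => width _)) => apply comp_width : cmp.
#[export] Hint Extern 1 (effective _ (fun x => clock _)) => apply comp_clock : cmp.
#[export] Hint Extern 1 (effective _ (fun x => path _)) => apply comp_path : cmp.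
#[export] Hint Extern 1 (effective _ (fun x => wait _)) => apply comp_wait : cmp.
#[export] Hint Extern 1 (effective _ (fun x => log _)) => apply comp_log : cmp.

Definition look (i : nat) (l : list (nat * status)) : status :=
  fold_right (fun p s => if fst p =? i then snd p else s) (Status 0 0 0 [] 0 0) l.

Definition hazard (n i : nat) : nat := n + i + 3.

Definition functional (i : nat) : nat := fst (Cantor.of_nat i).
Definition bounding (i : nat) : nat := snd (Cantor.of_nat i).

(** The visit scheduled by the clock: [0] is growth, [S i] is requirement [i]. *)
Definition turn (c : core) : nat := fst (Cantor.of_nat (clock c)).
Definition visit (c : core) : status := look (pred (turn c)) (log c).

Definition need (n : nat) (c : core) : nat :=
  if negb (fst (wait c) =? 0) then 1
  else if bushy (width c) (path c) (stem c) then width c * S (length (stem c))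
  else if turn c =? 0 then width c * S (length (stem c))
  else if phase (visit c) =? 0 then hazard n (pred (turn c)) + hazard n (pred (turn c))
  else 1.

Definition idle : nat * (nat * nat) := (0, (0, 0)).

Definition next (n : nat) (c : core) (v : nat) : core :=
  if negb (fst (wait c) =? 0) then
    let i := fst (snd (wait c)) in
    let x := snd (snd (wait c)) in
    let s := look i (log c) in
    let later := Core (stem c) (width c) (clock c) (path c) (fst (wait c), (i, S x)) (log c) in
    if fst (wait c) =? 1 then
      if halts_by (bounding i) (prog s) x then
        let h := fst (halt_cert x) in
        Core (stem c) (width c + h + S (hazard n i)) (clock c) (path c) idle
          ((i, Status (tries s) 2 (prog s) (stem c) (width c) h) :: log c)
      else later
    else if hit_by (functional i) (prog s) (width c) (stem c) x then
      Core (stem c) (width c) (clock c) (fst (fst (snd (snd (hit_cert x))))) idle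
        ((i, Status (tries s) 3 (prog s) (stem c) (width c) 0) :: log c)
    else later
  else if bushy (width c) (path c) (stem c) then
    Core (stem c ++ [nth v (kids (path c) (stem c)) 0]) (width c) (clock c) (path c) (wait c) (log c)
  else if turn c =? 0 then
    Core (stem c ++ [v]) (width c) (S (clock c)) (path c) (wait c) (log c)
  else
    let i := pred (turn c) in
    let x := snd (Cantor.of_nat (clock c)) in
    let s := visit c in
    if phase s =? 0 then
      Core (stem c) (width c) (S (clock c)) (path c)
        (if v <? 2 ^ hazard n i then if v =? 0 then (2, (i, 0)) else (1, (i, 0)) else idle)
        ((i, Status (S (tries s)) 1 (target (functional i) (stem c) (width c))
               (stem c) (width c) 0) :: log c)
    else if (phase s =? 1) && halts_by (bounding i) (prog s) x ||
            (phase s =? 2) && hit_by (functional i) (prog s) (at_width s) (at_stem s) x then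
      Core (stem c) (width c) (S (clock c)) (path c) idle
        ((i, Status (tries s) 0 0 [] 0 0) :: log c)
    else Core (stem c) (width c) (S (clock c)) (path c) idle (log c).

Inductive next_case (n : nat) (c : core) : nat -> (nat -> core) -> Prop :=
| capped i x : wait c = (1, (i, x)) ->
    halts_by (bounding i) (prog (look i (log c))) x = true ->
    next_case n c 1 (fun _ =>
      Core (stem c) (width c + fst (halt_cert x) + S (hazard n i)) (clock c) (path c) idle
        ((i, Status (tries (look i (log c))) 2 (prog (look i (log c)))
               (stem c) (width c) (fst (halt_cert x))) :: log c))
| found k i x : wait c = (k, (i, x)) -> k <> 0 -> k <> 1 ->
    hit_by (functional i) (prog (look i (log c))) (width c) (stem c) x = true ->
    next_case n c 1 (fun _ =>
      Core (stem c) (width c) (clock c) (fst (fst (snd (snd (hit_cert x))))) idle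
        ((i, Status (tries (look i (log c))) 3 (prog (look i (log c)))
               (stem c) (width c) 0) :: log c))
| waits k i x : wait c = (k, (i, x)) -> k <> 0 ->
    (k = 1 -> halts_by (bounding i) (prog (look i (log c))) x = false) ->
    (k <> 1 -> hit_by (functional i) (prog (look i (log c))) (width c) (stem c) x = false) ->
    next_case n c 1 (fun _ =>
      Core (stem c) (width c) (clock c) (path c) (k, (i, S x)) (log c))
| walks : fst (wait c) = 0 -> bushy (width c) (path c) (stem c) = true ->
    next_case n c (width c * S (length (stem c))) (fun v =>
      Core (stem c ++ [nth v (kids (path c) (stem c)) 0]) (width c) (clock c) (path c)
        (wait c) (log c))
| grows : fst (wait c) = 0 -> bushy (width c) (path c) (stem c) = false -> turn c = 0 ->
    next_case n c (width c * S (length (stem c))) (fun v =>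
      Core (stem c ++ [v]) (width c) (S (clock c)) (path c) (wait c) (log c))
| tosses i : fst (wait c) = 0 -> bushy (width c) (path c) (stem c) = false ->
    turn c = S i -> phase (look i (log c)) = 0 ->
    next_case n c (hazard n i + hazard n i) (fun v =>
      Core (stem c) (width c) (S (clock c)) (path c)
        (if v <? 2 ^ hazard n i then if v =? 0 then (2, (i, 0)) else (1, (i, 0)) else idle)
        ((i, Status (S (tries (look i (log c)))) 1 (target (functional i) (stem c) (width c))
               (stem c) (width c) 0) :: log c))
| refuted i : fst (wait c) = 0 -> bushy (width c) (path c) (stem c) = false ->
    turn c = S i ->
    (phase (look i (log c)) = 1 /\
       halts_by (bounding i) (prog (look i (log c))) (snd (Cantor.of_nat (clock c))) = true \/
     phase (look i (log c)) = 2 /\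
       hit_by (functional i) (prog (look i (log c))) (at_width (look i (log c)))
         (at_stem (look i (log c))) (snd (Cantor.of_nat (clock c))) = true) ->
    next_case n c 1 (fun _ =>
      Core (stem c) (width c) (S (clock c)) (path c) idle
        ((i, Status (tries (look i (log c))) 0 0 [] 0 0) :: log c))
| passes i : fst (wait c) = 0 -> bushy (width c) (path c) (stem c) = false ->
    turn c = S i -> phase (look i (log c)) <> 0 ->
    (phase (look i (log c)) = 1 ->
       halts_by (bounding i) (prog (look i (log c))) (snd (Cantor.of_nat (clock c))) = false) ->
    (phase (look i (log c)) = 2 ->
       hit_by (functional i) (prog (look i (log c))) (at_width (look i (log c)))
         (at_stem (look i (log c))) (snd (Cantor.of_nat (clock c))) = false) ->
    next_case n c 1 (fun _ =>
      Core (stem c) (width c) (S (clock c)) (path c) idle (log c)).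

Lemma next_spec n c : next_case n c (need n c) (next n c).
Proof.
  unfold need, next, visit.
  destruct (wait c) as [k [i x]] eqn:Ew; cbn [fst snd].
  destruct (Nat.eqb_spec k 0) as [->|Hk]; cbn [negb].
  2:{ destruct (Nat.eqb_spec k 1) as [->|Hk1].
      - destruct halts_by eqn:E.
        + now apply capped.
        + now apply waits.
      - destruct hit_by eqn:E.
        + now apply (found _ _ k).
        + now apply waits. }
  destruct bushy eqn:Eb.
  { rewrite <- Ew. apply walks; [now rewrite Ew|easy]. }
  destruct (Nat.eqb_spec (turn c) 0) as [Et|Et].
  { rewrite <- Ew. apply grows; [now rewrite Ew|easy..]. }
  destruct (turn c) as [|j] eqn:Ej; [easy|]. cbn [pred].
  destruct (Nat.eqb_spec (phase (look j (log c))) 0) as [Ep|Ep].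
  { apply tosses; try easy. now rewrite Ew. }
  destruct (orb _ _) eqn:E.
  - apply refuted; try easy; [now rewrite Ew|].
    now rewrite orb_true_iff, !andb_true_iff, !Nat.eqb_eq in E.
  - apply orb_false_iff in E. destruct E as [E1 E2].
    apply (passes _ _ j); try easy; try now rewrite Ew.
    + intro E. now rewrite E, Nat.eqb_refl in E1.
    + intro E. now rewrite E, Nat.eqb_refl in E2.
Qed.

Definition reader : Type := core * (nat * nat).

Definition read (n : nat) (r : reader) (b : bool) : reader :=
  let v := 2 * fst (snd r) + Nat.b2n b in
  if S (snd (snd r)) <? need n (fst r) then (fst r, (v, S (snd (snd r))))
  else (next n (fst r) v, (0, 0)).

Definition start (n : nat) : reader := (Core [] (S n) 0 (0, []) idle [], (0, 0)).

Definition run (n : nat) (s : list bool) : reader := fold_left (read n) s (start n).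

Lemma comp_look {O A} `{Enc A} (i : A -> nat) (l : A -> list (nat * status)) :
  effective O i -> effective O l -> effective O (fun x => look (i x) (l x)).
Proof. intros. unfold look. cmp. Qed.
#[export] Hint Extern 1 (effective _ (fun x => look _ _)) => apply comp_look : cmp.

Lemma comp_need {O A} `{Enc A} (n : A -> nat) (c : A -> core) :
  effective O n -> effective O c -> effective O (fun x => need (n x) (c x)).
Proof. intros. unfold need, visit, turn, hazard. cmp. Qed.
#[export] Hint Extern 1 (effective _ (fun x => need _ _)) => apply comp_need : cmp.

Lemma comp_next {O A} `{Enc A} (n : A -> nat) (c : A -> core) (v : A -> nat) :
  effective O n -> effective O c -> effective O v -> effective O (fun x => next (n x) (c x) (v x)).
Proof.
  intros. unfold next, visit, turn, hazard, functional, bounding, halt_cert, hit_cert.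
  cbv zeta. cmp.
Qed.
#[export] Hint Extern 1 (effective _ (fun x => next _ _ _)) => apply comp_next : cmp.

Lemma comp_b2n {O A} `{Enc A}
  (b : A -> bool) : effective O b -> effective O (fun x => Nat.b2n (b x)).
Proof. exact (comp_enc b). Qed.
#[export] Hint Extern 1 (effective _ (fun x => Nat.b2n _)) => apply comp_b2n : cmp.

Lemma comp_run {O A} `{Enc A} (n : A -> nat) (s : A -> list bool) :
  effective O n -> effective O s -> effective O (fun x => run (n x) (s x)).
Proof. intros. unfold run, read, start. cbv zeta. cmp. Qed.
#[export] Hint Extern 1 (effective _ (fun x => run _ _)) => apply comp_run : cmp.

(** * Invariants and finite sums *)

Record inv (n : nat) (c : core) : Prop := {
  inv_width : S n <= width c;
  inv_prog : forall i, phase (look i (log c)) = 1 \/ phase (look i (log c)) = 2 ->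
    prog (look i (log c)) =
    target (functional i) (at_stem (look i (log c))) (at_width (look i (log c)));
  inv_cap : forall i, phase (look i (log c)) = 2 ->
    phi (char empty) (bounding i) (prog (look i (log c))) (cap (look i (log c))) /\
    at_width (look i (log c)) + cap (look i (log c)) + S (hazard n i) <= width c;
  inv_wait : forall k i x, wait c = (k, (i, x)) -> k <> 0 ->
    phase (look i (log c)) = 1 /\ at_stem (look i (log c)) = stem c /\
    at_width (look i (log c)) = width c }.

Lemma look_cons i i' s l :
  look i ((i', s) :: l) = if Nat.eqb i' i then s else look i l.
Proof. reflexivity. Qed.

Lemma inv_start n : inv n (fst (start n)).
Proof.
  split; cbn; [easy|lia|lia|]. intros k i x E. now injection E as <- _ _.
Qed.

Lemma inv_next n c v : inv n c -> inv n (next n c v).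
Proof.
  intros [Iw Ip Ic Ix]. destruct (next_spec n c) as
    [i x Ew Eh|k i x Ew Hk Hk1 Eh|k i x Ew Hk _ _|Ew Eb|Ew Eb Et|i Ew Eb Et Ep|i Ew Eb Et _|i Ew Eb Et _ _ _].
  - destruct (Ix _ _ _ Ew ltac:(easy)) as (P1 & S1 & W1). split; cbn [width log wait stem].
    + lia.
    + intros i'. rewrite look_cons. destruct (Nat.eqb_spec i i') as [<-|]; cbn; [|apply Ip].
      intros _. rewrite <- S1, <- W1. apply Ip. now left.
    + intros i'. rewrite look_cons. destruct (Nat.eqb_spec i i') as [<-|]; cbn.
      * intros _. split; [now apply halts_by_phi|lia].
      * intro E. destruct (Ic i' E). split; [easy|lia].
    + intros k i' x' E. injection E as <- _ _. easy.
  - destruct (Ix _ _ _ Ew Hk) as (P1 & S1 & W1). split; cbn [width log wait stem]; auto.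
    + intros i'. rewrite look_cons. destruct (Nat.eqb_spec i i') as [<-|]; cbn; [lia|apply Ip].
    + intros i'. rewrite look_cons. destruct (Nat.eqb_spec i i') as [<-|]; cbn; [lia|apply Ic].
    + intros k' i' x' E. injection E as <- _ _. easy.
  - destruct (Ix _ _ _ Ew Hk) as (P1 & S1 & W1). split; cbn [width log wait stem]; auto.
    intros k' i' x' E. injection E as <- <- _. easy.
  - split; cbn [width log wait stem]; auto.
    intros k i x E. rewrite E in Ew. cbn in Ew. easy.
  - split; cbn [width log wait stem]; auto.
    intros k i x E. rewrite E in Ew. cbn in Ew. easy.
  - split; cbn [width log wait stem]; auto.
    + intros i'. rewrite look_cons. destruct (Nat.eqb_spec i i') as [<-|]; cbn; [easy|apply Ip].
    + intros i'. rewrite look_cons. destruct (Nat.eqb_spec i i') as [<-|]; cbn; [lia|apply Ic].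
    + intros k' i' x' E Hk.
      assert (i' = i) as ->.
      { destruct (v <? _); [destruct (v =? 0)|]; injection E; intros; subst; easy. }
      rewrite look_cons, Nat.eqb_refl. easy.
  - split; cbn [width log wait stem]; auto.
    + intros i'. rewrite look_cons. destruct (Nat.eqb_spec i i') as [<-|]; cbn; [lia|apply Ip].
    + intros i'. rewrite look_cons. destruct (Nat.eqb_spec i i') as [<-|]; cbn; [lia|apply Ic].
    + intros k' i' x' E. injection E as <- _ _. easy.
  - split; cbn [width log wait stem]; auto.
    intros k' i' x' E. injection E as <- _ _. easy.
Qed.

Lemma need_pos n c : inv n c -> 0 < need n c.
Proof.
  intros [Iw _ _ _]. destruct (next_spec n c); unfold hazard; nia.
Qed.

Local Open Scope R_scope.

Fixpoint rsum (n : nat) (F : nat -> R) : R :=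
  match n with
  | O => 0
  | S m => rsum m F + F m
  end.

Lemma rsum_le n F G : (forall v, (v < n)%nat -> F v <= G v) -> rsum n F <= rsum n G.
Proof.
  induction n as [|n IH]; intro H; cbn; [lra|].
  apply Rplus_le_compat; [apply IH|]; auto with arith.
Qed.

Lemma rsum_ext n F G : (forall v, (v < n)%nat -> F v = G v) -> rsum n F = rsum n G.
Proof. induction n as [|n IH]; intro H; cbn; [lra|]. rewrite IH, H; auto with arith. Qed.

Lemma rsum_const n x : rsum n (fun _ => x) = INR n * x.
Proof. induction n as [|n IH]; [cbn; lra|]. cbn [rsum]. rewrite IH, S_INR. lra. Qed.

Lemma rsum_plus n F G : rsum n (fun v => F v + G v) = rsum n F + rsum n G.
Proof. induction n as [|n IH]; cbn; [lra|]. rewrite IH. lra. Qed.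

Lemma rsum_scal n x F : rsum n (fun v => x * F v) = x * rsum n F.
Proof. induction n as [|n IH]; cbn; [lra|]. rewrite IH. lra. Qed.

Lemma rsum_split a b F : rsum (a + b) F = rsum a F + rsum b (fun v => F (a + v)%nat).
Proof.
  induction b as [|b IH]; cbn.
  - rewrite Nat.add_0_r. lra.
  - rewrite Nat.add_succ_r. cbn. rewrite IH. lra.
Qed.

Lemma rsum_bound n F x : (forall v, (v < n)%nat -> F v <= x) -> rsum n F <= INR n * x.
Proof. intro H. rewrite <- rsum_const. now apply rsum_le. Qed.

Lemma rsum_count n (P : nat -> bool) u F :
  (forall v, (v < n)%nat -> F v <= (if P v then 1 else 0) + u) ->
  rsum n F <= INR (length (filter P (seq 0 n))) + INR n * u.
Proof.
  intro H. eapply Rle_trans; [apply rsum_le, H|]. rewrite rsum_plus, rsum_const.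
  apply Rplus_le_compat_r. clear. induction n as [|n IH]; [cbn; lra|].
  cbn [rsum]. rewrite seq_S, filter_app, length_app. cbn [Nat.add filter].
  rewrite plus_INR. destruct (P n); cbn [length INR]; lra.
Qed.

Lemma INR_pow2 n : INR (2 ^ n) = 2 ^ n.
Proof. rewrite pow_INR. reflexivity. Qed.

Lemma half_pow n : (/ 2) ^ n * 2 ^ n = 1.
Proof. rewrite <- Rpow_mult_distr. replace (/ 2 * 2) with 1 by lra. apply pow1. Qed.

Lemma half_pow_pos n : 0 < (/ 2) ^ n.
Proof. apply pow_lt. lra. Qed.

Lemma half_pow_le m n : (m <= n)%nat -> (/ 2) ^ n <= (/ 2) ^ m.
Proof.
  intro L. replace n with (m + (n - m))%nat by lia. rewrite pow_add.
  rewrite <- (Rmult_1_r ((/ 2) ^ m)) at 2. apply Rmult_le_compat_l.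
  - apply Rlt_le, half_pow_pos.
  - rewrite <- (pow1 (n - m)). apply pow_incr. lra.
Qed.

Definition supermartingale (n : nat) (V : core -> R) : Prop :=
  forall c, inv n c ->
    rsum (2 ^ need n c) (fun v => V (next n c v)) <= INR (2 ^ need n c) * V c.

Lemma nth_kids_inj p t v v' : (v < length (kids p t))%nat -> (v' < length (kids p t))%nat ->
  nth v (kids p t) 0%nat = nth v' (kids p t) 0%nat -> v = v'.
Proof. intros L L'. apply (proj1 (NoDup_nth _ 0%nat) (kids_NoDup p t)); easy. Qed.

Lemma walk_inj j p t v v' : bushy j p t = true ->
  (v < 2 ^ (j * S (length t)))%nat -> (v' < 2 ^ (j * S (length t)))%nat ->
  nth v (kids p t) 0%nat = nth v' (kids p t) 0%nat -> v = v'.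
Proof.
  unfold bushy. rewrite Nat.leb_le. intros B L L'. apply nth_kids_inj; lia.
Qed.

Definition injective_below (N : nat) (child : nat -> nat) : Prop :=
  forall v v', (v < N)%nat -> (v' < N)%nat -> child v = child v' -> v = v'.

Lemma filter_injective_length N child (P : nat -> bool) :
  injective_below N child ->
  NoDup (map child (filter (fun v => P (child v)) (seq 0 N))).
Proof.
  intro Hi. pose proof (NoDup_filter (fun v => P (child v)) (seq_NoDup N 0)) as ND.
  assert (L : forall v, In v (filter (fun v => P (child v)) (seq 0 N)) -> (v < N)%nat).
  { intros v I. apply filter_In in I. destruct I as [I _]. apply in_seq in I. lia. }
  induction ND as [|v l Nv ND IH]; cbn; constructor.
  - intro I. apply in_map_iff in I. destruct I as (v' & E & I'). apply Nv.
    rewrite <- (Hi v' v); [easy|apply L; now right|apply L; now left|easy].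
  - apply IH. intros v' I. apply L. now right.
Qed.

Definition growth_ok (n : nat) (j : nat) (V : list nat -> R) (s : list nat) : Prop :=
  forall child, injective_below (2 ^ (j * S (length s))) child ->
    rsum (2 ^ (j * S (length s))) (fun v => V (s ++ [child v])) <=
    INR (2 ^ (j * S (length s))) * V s.

(** The chance [p] that an attempt at requirement [i] waits for [h(e)]; given
    that, it waits for a hit instead with the same chance [p]. *)
Definition chance (n i : nat) : R := (/ 2) ^ hazard n i.
Definition limit_tries (n i : nat) : nat := 2 ^ (3 * hazard n i).

(** The second summand bounds the chance that every remaining attempt comes out
    undecided. *)
Definition worth (n i t : nat) : R :=
  2 * chance n i + / (1 + INR (limit_tries n i - t) * (chance n i * chance n i)).

Definition avoided (i : nat) (s : status) (t : list nat) : Prop :=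
  ~ big (at_width s + cap s)
      (fun u => exists v, (v < cap s)%nat /\ sphi u (functional i) (prog s) v) t.

Definition hit_at (i : nat) (s : status) : Prop :=
  hit (functional i) (prog s) (at_width s) (at_stem s).

(** [k] is what the process waits for on behalf of requirement [i]: [0] nothing,
    [1] the value [h(e)], otherwise a hit. *)
Definition risk (n i k : nat) (s : status) (t : list nat) : R :=
  match k with
  | 0%nat =>
      match phase s with
      | 0%nat => worth n i (tries s)
      | 1%nat => if decide (halts (bounding i) (prog s)) then worth n i (tries s) else 0
      | 2%nat => if decide (hit_at i s) then worth n i (tries s)
             else if decide (avoided i s t)
                  then 2 * (/ 2) ^ (S (hazard n i) * S (length t)) else 1
      | _ => 0
      end
  | 1%nat =>
      if decide (halts (bounding i) (prog s))
      then if decide (hit_at i s) then worth n i (tries s) else chance n i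
      else 1
  | _ => if decide (hit_at i s) then 0 else 1
  end.

Definition wait_for (i : nat) (c : core) : nat :=
  if Nat.eqb (fst (snd (wait c))) i then fst (wait c) else 0%nat.

Definition requirement_risk (n i : nat) (c : core) : R :=
  risk n i (wait_for i c) (look i (log c)) (stem c).

Lemma chance_pos n i : 0 < chance n i.
Proof. apply half_pow_pos. Qed.

Lemma chance_small n i : chance n i <= / 8.
Proof.
  replace (/ 8) with ((/ 2) ^ 3) by (cbn; lra). apply half_pow_le. unfold hazard. lia.
Qed.

Lemma worth_tail_pos n i m : 0 < / (1 + INR m * (chance n i * chance n i)).
Proof.
  apply Rinv_0_lt_compat. pose proof (pos_INR m). pose proof (chance_pos n i).
  pose proof (Rmult_le_pos (INR m) (chance n i * chance n i)). nra.
Qed.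

Lemma worth_bounds n i t : 2 * chance n i <= worth n i t.
Proof. unfold worth. pose proof (worth_tail_pos n i (limit_tries n i - t)). lra. Qed.

Lemma worth_late n i t : (limit_tries n i <= t)%nat -> 1 <= worth n i t.
Proof.
  intro L. unfold worth. replace (limit_tries n i - t)%nat with 0%nat by lia.
  cbn [INR]. rewrite Rmult_0_l, Rplus_0_r, Rinv_1. pose proof (chance_pos n i). lra.
Qed.

(** [(1 - x) / (1 + (m - 1) x) <= 1 / (1 + m x)] with [x = p^2]. *)
Lemma worth_step n i t :
  (1 - chance n i * chance n i) * (worth n i (S t) - 2 * chance n i) <= worth n i t - 2 * chance n i.
Proof.
  unfold worth. pose proof (chance_pos n i) as P. pose proof (chance_small n i) as P'.
  set (p := chance n i) in *. set (x := p * p). assert (Hx : 0 < x <= 1) by (unfold x; nra).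
  ring_simplify (2 * p + / (1 + INR (limit_tries n i - S t) * x) - 2 * p).
  ring_simplify (2 * p + / (1 + INR (limit_tries n i - t) * x) - 2 * p).
  destruct (limit_tries n i - t)%nat as [|m] eqn:E.
  - replace (limit_tries n i - S t)%nat with 0%nat by lia. cbn [INR].
    rewrite Rmult_0_l, Rplus_0_r, Rinv_1. lra.
  - replace (limit_tries n i - S t)%nat with m by lia. rewrite S_INR.
    pose proof (pos_INR m). assert (0 <= INR m * x) by nra.
    apply (Rmult_le_reg_r ((1 + INR m * x) * (1 + (INR m + 1) * x))); [nra|].
    field_simplify; [|nra|nra]. nra.
Qed.

Lemma worth_start n i : worth n i 0 <= (/ 2) ^ (n + i + 1).
Proof.
  unfold worth, limit_tries. rewrite Nat.sub_0_r, INR_pow2.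
  unfold chance. pose proof (half_pow (hazard n i)) as E.
  pose proof (half_pow_pos (hazard n i)) as P.
  replace (2 ^ (3 * hazard n i)) with (2 ^ hazard n i * 2 ^ hazard n i * 2 ^ hazard n i)
    by (rewrite <- !pow_add; f_equal; lia).
  replace ((/ 2) ^ (n + i + 1)) with (4 * (/ 2) ^ hazard n i).
  2:{ unfold hazard. replace (n + i + 3)%nat with (n + i + 1 + 2)%nat by lia.
      rewrite (pow_add _ (n + i + 1)). cbn [pow]. lra. }
  set (p := (/ 2) ^ hazard n i) in *. set (q := 2 ^ hazard n i) in *.
  replace (q * q * q * (p * p)) with (q * (p * q) * (p * q)) by ring. rewrite E.
  assert (0 < q) by (apply pow_lt; lra).
  enough (/ (1 + q * 1 * 1) <= p) by lra.
  replace p with (/ q) by (field_simplify_eq; lra).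
  apply Rinv_le_contravar; lra.
Qed.

(** * Supermartingales *)

Lemma growth_const n j x s : growth_ok n j (fun _ => x) s.
Proof. intros child _. rewrite rsum_const. lra. Qed.

Lemma decide_elim P : decide P = true -> P.
Proof. apply decide_iff. Qed.

Lemma decide_true P : P -> decide P = true.
Proof. apply decide_iff. Qed.

Lemma decide_false P : ~ P -> decide P = false.
Proof. intro N. destruct (decide P) eqn:E; [|easy]. now apply decide_elim in E. Qed.

Lemma promise_le (K l : nat) : 2 * (/ 2) ^ (S K * S l) <= (/ 2) ^ K.
Proof.
  replace ((/ 2) ^ K) with (2 * (/ 2) ^ S K) by (cbn; lra).
  apply Rmult_le_compat_l; [lra|]. apply half_pow_le. nia.
Qed.

Lemma half_pow_le_1 n : (/ 2) ^ n <= 1.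
Proof. apply (half_pow_le 0). lia. Qed.

Lemma growth_avoided n i s j t :
  (at_width s + cap s + S (hazard n i) <= j)%nat ->
  growth_ok n j (fun t => if decide (avoided i s t)
    then 2 * (/ 2) ^ (S (hazard n i) * S (length t)) else 1) t.
Proof.
  set (K := hazard n i). set (J := (at_width s + cap s)%nat). intros L child Hinj.
  set (N := (2 ^ (j * S (length t)))%nat) in *.
  destruct (excluded_middle_informative (avoided i s t)) as [Av|Av].
  2:{ rewrite (decide_false _ Av). apply rsum_bound. intros v _.
      destruct decide; [|lra]. eapply Rle_trans; [apply promise_le|apply half_pow_le_1]. }
  rewrite (decide_true _ Av).
  set (x := (/ 2) ^ (S K * S (length t))).
  assert (Hx : 0 < x) by apply half_pow_pos.
  eapply Rle_trans.
  { apply (rsum_count N (fun v => negb (decide (avoided i s (t ++ [child v])))) x).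
    intros v _. destruct decide; cbn [negb]; [|lra]. rewrite length_app. cbn [length].
    replace (S K * S (length t + 1))%nat with (S K * S (length t) + S K)%nat by lia.
    rewrite pow_add. fold x. cbn [pow]. pose proof (half_pow_le_1 K). nra. }
  set (P := fun w => negb (decide (avoided i s (t ++ [w])))).
  pose proof (filter_injective_length N child P Hinj) as ND.
  assert (C : (length (filter (fun v => P (child v)) (seq 0 N)) <= 2 ^ (J * S (length t)))%nat).
  { apply Nat.lt_le_incl. destruct (le_lt_dec (2 ^ (J * S (length t)))
      (length (filter (fun v => P (child v)) (seq 0 N)))) as [G|G]; [|easy].
    exfalso. apply Av. apply (big_node _ _ _ _ ND).
    - now rewrite length_map.
    - intros w Hw. apply in_map_iff in Hw. destruct Hw as (v & <- & Hv).
      apply filter_In in Hv. destruct Hv as [_ Hv]. unfold P in Hv.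
      destruct (decide _) eqn:D in Hv; [easy|].
      apply NNPP. intro B. apply decide_true in B. unfold avoided in D. congruence. }
  apply le_INR in C. rewrite INR_pow2 in C. fold P.
  enough (2 ^ (J * S (length t)) <= INR N * x) by (unfold P in *; lra).
  unfold N, x. rewrite INR_pow2.
  replace (j * S (length t))%nat with
    (J * S (length t) + S K * S (length t) + (j - J - S K) * S (length t))%nat by nia.
  rewrite !pow_add. set (y := 2 ^ (J * S (length t))).
  pose proof (half_pow (S K * S (length t))) as E.
  set (a := (/ 2) ^ (S K * S (length t))) in *. set (b := 2 ^ (S K * S (length t))) in *.
  assert (1 <= 2 ^ ((j - J - S K) * S (length t))) by (apply pow_R1_Rle; lra).
  set (z := 2 ^ ((j - J - S K) * S (length t))) in *.
  assert (0 < y) by (apply pow_lt; lra).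
  replace (y * b * z * a) with (y * z * (a * b)) by ring. rewrite E. nra.
Qed.

Lemma growth_risk n i s j t :
  (phase s = 2%nat -> (at_width s + cap s + S (hazard n i) <= j)%nat) ->
  growth_ok n j (risk n i 0 s) t.
Proof.
  intro L. unfold risk. destruct (phase s) as [|[|[|]]]; try apply growth_const.
  destruct (decide (hit_at i s)); [apply growth_const|].
  apply growth_avoided. auto.
Qed.

Lemma walk_injective j p t : bushy j p t = true ->
  injective_below (2 ^ (j * S (length t))) (fun v => nth v (kids p t) 0%nat).
Proof. intros B v v'. now apply (walk_inj j). Qed.

Lemma need_one V (c c' : core) : V c' <= V c ->
  rsum (2 ^ 1) (fun _ => V c') <= INR (2 ^ 1) * V c.
Proof. intro H. rewrite rsum_const. apply Rmult_le_compat_l; [apply pos_INR|easy]. Qed.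

Lemma wait_for_idle i c : fst (wait c) = 0%nat -> wait_for i c = 0%nat.
Proof. unfold wait_for. intros ->. now destruct (_ =? i)%nat. Qed.

Lemma risk_log n i i' s c k j m p x :
  i' <> i -> fst (wait c) = 0%nat \/ fst (snd (wait c)) <> i ->
  k = 0%nat \/ fst x = i' ->
  requirement_risk n i (Core (stem c) j m p (k, x) ((i', s) :: log c)) =
  requirement_risk n i c.
Proof.
  intros N W X. unfold requirement_risk. cbn [log stem]. rewrite look_cons.
  destruct (Nat.eqb_spec i' i); [easy|]. f_equal.
  assert (wait_for i c = 0%nat) as ->.
  { destruct W as [W|W]; [now apply wait_for_idle|].
    unfold wait_for. destruct (Nat.eqb_spec (fst (snd (wait c))) i); easy. }
  unfold wait_for. cbn [wait fst snd]. destruct X as [->|X].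
  - now destruct (_ =? i)%nat.
  - rewrite X. destruct (Nat.eqb_spec i' i); easy.
Qed.

Lemma toss_sum (k : nat) (F : nat -> R) x y z :
  F 0%nat = x -> (forall v, (0 < v < 2 ^ k)%nat -> F v = y) ->
  (forall v, (2 ^ k <= v)%nat -> F v = z) ->
  rsum (2 ^ (k + k)) F = x + (2 ^ k - 1) * y + (2 ^ k * 2 ^ k - 2 ^ k) * z.
Proof.
  intros Hx Hy Hz. pose proof (pow2_pos k) as P.
  replace (2 ^ (k + k))%nat with (1 + (2 ^ k - 1) + (2 ^ k * 2 ^ k - 2 ^ k))%nat.
  2:{ rewrite Nat.pow_add_r. nia. }
  rewrite !rsum_split. cbn [rsum].
  rewrite (rsum_ext (2 ^ k - 1) _ (fun _ => y)) by (intros; apply Hy; lia).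
  rewrite (rsum_ext (2 ^ k * 2 ^ k - 2 ^ k) _ (fun _ => z)) by (intros; apply Hz; lia).
  rewrite !rsum_const, !minus_INR, mult_INR, INR_pow2 by nia.
  rewrite Hx. cbn [INR]. lra.
Qed.

Lemma toss_ok n i t x y z :
  (x <= 1 /\ y <= 1 /\ z <= 0 \/
   x <= 1 /\ y <= chance n i /\ z <= worth n i (S t) \/
   x <= 0 /\ y <= worth n i (S t) /\ z <= worth n i (S t)) ->
  x + (2 ^ hazard n i - 1) * y + (2 ^ hazard n i * 2 ^ hazard n i - 2 ^ hazard n i) * z <=
  2 ^ hazard n i * 2 ^ hazard n i * worth n i t.
Proof.
  pose proof (worth_step n i t) as W. pose proof (worth_bounds n i t) as B.
  pose proof (worth_bounds n i (S t)) as B'. pose proof (half_pow (hazard n i)) as E.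
  fold (chance n i) in E. pose proof (chance_pos n i) as P. pose proof (chance_small n i) as P8.
  set (p := chance n i) in *. set (q := 2 ^ hazard n i) in *.
  assert (1 <= q) by (apply pow_R1_Rle; lra).
  set (w := worth n i t) in *. set (w' := worth n i (S t)) in *.
  assert (Q : q * q * (p * p) = 1) by (replace (q * q * (p * p)) with ((p * q) * (p * q)) by ring; rewrite E; ring).
  assert (W' : (q * q - 1) * (w' - 2 * p) <= q * q * (w - 2 * p)).
  { replace (q * q - 1) with (q * q * (1 - p * p)) by nra.
    rewrite Rmult_assoc. apply Rmult_le_compat_l; nra. }
  assert (QP : q * q * p = q) by (replace (q * q * p) with (q * (p * q)) by ring; rewrite E; ring).
  assert (1 <= q * q) by nra. assert (q <= q * q) by nra.
  intros [(Hx & Hy & Hz)|[(Hx & Hy & Hz)|(Hx & Hy & Hz)]].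
  - assert ((q - 1) * y <= q - 1) by nra. assert ((q * q - q) * z <= 0) by nra.
    assert (q * q * (2 * p) <= q * q * w) by nra. nra.
  - assert ((q - 1) * y <= (q - 1) * p) by (apply Rmult_le_compat_l; lra).
    assert ((q * q - q) * z <= (q * q - q) * w') by (apply Rmult_le_compat_l; lra).
    assert ((q * q - q) * (w' - 2 * p) <= (q * q - 1) * (w' - 2 * p)) by (apply Rmult_le_compat_r; lra).
    nra.
  - assert ((q - 1) * y <= (q - 1) * w') by (apply Rmult_le_compat_l; lra).
    assert ((q * q - q) * z <= (q * q - q) * w') by (apply Rmult_le_compat_l; lra).
    nra.
Qed.

Lemma requirement_supermartingale n i : supermartingale n (requirement_risk n i).
Proof.
  intros c I. pose proof I as [Iw Ip Ic Ix]. destruct (next_spec n c) as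
    [i' x Ew Eh|k i' x Ew Hk Hk1 Eh|k i' x Ew Hk _ _|Ew Eb|Ew Eb Et|i' Ew Eb Et Ep|i' Ew Eb Et E|i' Ew Eb Et _ _ _].
  - apply need_one. destruct (Nat.eq_dec i' i) as [->|N].
    2:{ unfold idle. rewrite risk_log; [lra|easy| |now left]. right. now rewrite Ew. }
    destruct (Ix _ _ _ Ew ltac:(easy)) as (P1 & S1 & W1).
    unfold requirement_risk, wait_for. cbn [wait log stem idle fst snd].
    rewrite Ew, look_cons, Nat.eqb_refl. cbn [fst snd]. rewrite Nat.eqb_refl.
    pose proof (Ip i (or_introl P1)) as EP. rewrite S1, W1 in EP.
    set (s := look i (log c)) in *. destruct (0 =? i)%nat; cbn [risk phase tries];
    unfold hit_at; cbn [prog at_stem at_width];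
    (rewrite (decide_true (halts (bounding i) (prog s))) by (eexists; apply halts_by_phi, Eh));
    rewrite S1, W1;
    (destruct (decide (hit _ _ _ _)) eqn:D; [lra|]);
    (rewrite decide_true; [apply promise_le|]);
    intro B; unfold avoided in B; cbn [at_width cap prog] in B;
    apply big_pigeonhole in B; destruct B as (v & _ & B);
    rewrite EP in B, D; apply target_hit in B;
    apply decide_true in B; congruence.
  - apply need_one. destruct (Nat.eq_dec i' i) as [->|N].
    2:{ unfold idle. rewrite risk_log; [lra|easy| |now left]. right. now rewrite Ew. }
    destruct (Ix _ _ _ Ew Hk) as (P1 & S1 & W1).
    unfold requirement_risk, wait_for. cbn [wait log stem idle fst snd].
    rewrite Ew, look_cons, Nat.eqb_refl. cbn [fst snd]. rewrite Nat.eqb_refl.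
    destruct (0 =? i)%nat; destruct k as [|[|k]]; cbn [risk phase]; try lia;
    (destruct (decide (hit_at i (look i (log c)))); lra).
  - apply need_one. apply Req_le. unfold requirement_risk, wait_for.
    cbn [wait log stem]. now rewrite Ew.
  - assert (G : growth_ok n (width c) (risk n i 0 (look i (log c))) (stem c)).
    { apply growth_risk. intro P2. now apply (Ic i). }
    specialize (G _ (walk_injective _ _ _ Eb)).
    unfold requirement_risk. cbn [stem log].
    rewrite (wait_for_idle i c Ew). erewrite rsum_ext; [apply G|].
    intros v _. now rewrite wait_for_idle.
  - assert (G : growth_ok n (width c) (risk n i 0 (look i (log c))) (stem c)).
    { apply growth_risk. intro P2. now apply (Ic i). }
    specialize (G (fun v => v) ltac:(easy)).
    unfold requirement_risk. cbn [stem log].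
    rewrite (wait_for_idle i c Ew). erewrite rsum_ext; [apply G|].
    intros v _. now rewrite wait_for_idle.
  - destruct (Nat.eq_dec i' i) as [->|N].
    2:{ erewrite rsum_ext; [rewrite rsum_const; apply Rle_refl|]. intros v _.
        destruct (v <? _)%nat; [destruct (v =? 0)%nat|]; apply risk_log; auto. }
    unfold requirement_risk at 2. rewrite (wait_for_idle i c Ew). cbn [risk]. rewrite Ep.
    set (s' := Status (S (tries (look i (log c)))) 1 (target (functional i) (stem c) (width c))
               (stem c) (width c) 0).
    erewrite (toss_sum _ _ (risk n i 2 s' (stem c)) (risk n i 1 s' (stem c)) (risk n i 0 s' (stem c))).
    + rewrite INR_pow2, pow_add. apply toss_ok. cbn [risk].
      change (phase s') with 1%nat. change (tries s') with (S (tries (look i (log c)))).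
      cbv iota.
      pose proof (worth_bounds n i (S (tries (look i (log c))))).
      pose proof (chance_pos n i).
      destruct (decide (halts _ _)), (decide (hit_at i s')); lra.
    + unfold requirement_risk, wait_for. cbn [wait log stem]. rewrite look_cons, Nat.eqb_refl.
      pose proof (pow2_pos (hazard n i)).
      destruct (Nat.ltb_spec 0 (2 ^ hazard n i)); [|lia]. cbn [Nat.eqb fst snd].
      now rewrite Nat.eqb_refl.
    + intros v Hv. unfold requirement_risk, wait_for. cbn [wait log stem].
      rewrite look_cons, Nat.eqb_refl. destruct (Nat.ltb_spec v (2 ^ hazard n i)); [|lia].
      destruct (Nat.eqb_spec v 0); [lia|]. cbn [fst snd]. now rewrite Nat.eqb_refl.
    + intros v Hv. unfold requirement_risk, wait_for. cbn [wait log stem].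
      rewrite look_cons, Nat.eqb_refl. destruct (Nat.ltb_spec v (2 ^ hazard n i)); [lia|].
      cbn [fst snd idle]. now destruct (0 =? i)%nat.
  - apply need_one. destruct (Nat.eq_dec i' i) as [->|N].
    2:{ unfold idle. rewrite risk_log; [lra|easy|now left|now left]. }
    unfold requirement_risk. rewrite (wait_for_idle i c Ew), wait_for_idle by easy.
    cbn [log stem]. rewrite look_cons, Nat.eqb_refl. cbn [risk phase tries].
    destruct E as [[-> E]|[-> E]].
    + rewrite decide_true; [lra|]. eexists. eapply halts_by_phi, E.
    + rewrite decide_true; [lra|]. eapply hit_by_hit, E.
  - apply need_one. apply Req_le. unfold requirement_risk. cbn [log stem].
    now rewrite !wait_for_idle.
Qed.

Definition broken (n i : nat) (c : core) : Prop :=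
  wait_for i c = 1%nat /\ ~ halts (bounding i) (prog (look i (log c))) \/
  (2 <= wait_for i c)%nat /\ ~ hit_at i (look i (log c)) \/
  phase (look i (log c)) = 0%nat /\ (limit_tries n i <= tries (look i (log c)))%nat \/
  phase (look i (log c)) = 2%nat /\ ~ hit_at i (look i (log c)) /\
    ~ avoided i (look i (log c)) (stem c).

Lemma broken_risk n i c : inv n c -> broken n i c -> 1 <= requirement_risk n i c.
Proof.
  intros [Iw Ip Ic Ix] B. unfold requirement_risk.
  destruct (wait_for i c) as [|k] eqn:Ek.
  - cbn [risk]. destruct B as [[B _]|[[B _]|[[-> B]|(-> & B & B')]]]; try lia.
    + now apply worth_late.
    + rewrite !decide_false by easy. lra.
  - assert (P1 : phase (look i (log c)) = 1%nat).
    { unfold wait_for in Ek. destruct (wait c) as [k' [i' x]] eqn:Ew. cbn [fst snd] in Ek.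
      destruct (Nat.eqb_spec i' i) as [->|]; [|lia]. now apply (Ix k' i x); [|lia]. }
    destruct B as [[B B']|[[B B']|[[B _]|(B & _)]]]; try congruence.
    + rewrite Ek in B. injection B as ->. cbn [risk]. rewrite decide_false by easy. lra.
    + destruct k as [|k]; [lia|]. cbn [risk]. rewrite decide_false by easy. lra.
Qed.

Lemma risk_nonneg n i c : 0 <= requirement_risk n i c.
Proof.
  unfold requirement_risk. pose proof (worth_bounds n i (tries (look i (log c)))).
  pose proof (chance_pos n i).
  pose proof (half_pow_pos (S (hazard n i) * S (length (stem c)))).
  destruct (wait_for i c) as [|[|]]; cbn [risk]; [|destruct decide; [destruct decide|]; lra|destruct decide; lra].
  destruct (phase _) as [|[|[|]]]; repeat match goal with |- context [decide ?P] => destruct (decide P) end; lra.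
Qed.

Lemma risk_start n i : requirement_risk n i (fst (start n)) <= (/ 2) ^ (n + i + 1).
Proof.
  unfold requirement_risk. rewrite wait_for_idle by easy. apply worth_start.
Qed.

Definition collision (X : binseq) (l : nat) (c : core) : Prop :=
  (l < length (stem c))%nat /\ phi (char X) l l (nth l (stem c) 0%nat).

Definition collision_risk (X : binseq) (n l : nat) (c : core) : R :=
  if (l <? length (stem c))%nat
  then if decide (phi (char X) l l (nth l (stem c) 0%nat)) then 1 else 0
  else (/ 2) ^ (S n * S l).

Lemma filter_unique_length (P : nat -> bool) N :
  (forall v v', (v < N)%nat -> (v' < N)%nat -> P v = true -> P v' = true -> v = v') ->
  (length (filter P (seq 0 N)) <= 1)%nat.
Proof.
  intro U. pose proof (NoDup_filter P (seq_NoDup N 0)) as ND.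
  assert (L : forall v, In v (filter P (seq 0 N)) -> (v < N)%nat /\ P v = true).
  { intros v I. apply filter_In in I. destruct I as [I ?]. apply in_seq in I. split; [lia|easy]. }
  destruct (filter P (seq 0 N)) as [|a [|b l]]; cbn; try lia. exfalso.
  inversion_clear ND as [|? ? N1 _]. apply N1. left. symmetry.
  apply U; apply L; cbn; auto.
Qed.

Lemma growth_collision X n l j t : (S n <= j)%nat ->
  growth_ok n j (fun t => if (l <? length t)%nat
    then if decide (phi (char X) l l (nth l t 0%nat)) then 1 else 0
    else (/ 2) ^ (S n * S l)) t.
Proof.
  intros L child Hinj. destruct (Nat.ltb_spec l (length t)) as [Hl|Hl].
  { erewrite rsum_ext; [rewrite rsum_const; apply Rle_refl|]. intros v _. cbv beta.
    rewrite length_app, app_nth1 by easy.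
    destruct (Nat.ltb_spec l (length t + length [child v])); [easy|lia]. }
  destruct (Nat.eq_dec l (length t)) as [->|N].
  2:{ erewrite rsum_ext; [rewrite rsum_const; apply Rle_refl|]. intros v _. cbv beta.
      rewrite length_app. cbn [length].
      destruct (Nat.ltb_spec l (length t + 1)); [lia|easy]. }
  set (M := (2 ^ (j * S (length t)))%nat) in *.
  eapply Rle_trans.
  { apply (rsum_count M (fun v => decide (phi (char X) (length t) (length t) (child v))) 0).
    intros v _. rewrite length_app. cbn [length].
    destruct (Nat.ltb_spec (length t) (length t + 1)); [|lia].
    rewrite app_nth2, Nat.sub_diag by lia. cbn [nth]. lra. }
  assert (C : (length (filter (fun v => decide (phi (char X) (length t) (length t) (child v)))
    (seq 0 M)) <= 1)%nat).
  { apply filter_unique_length. intros v v' Lv Lv' E E'. apply decide_elim in E, E'.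
    apply Hinj; try easy. eapply phi_functional; eassumption. }
  apply le_INR in C. cbn [INR] in C. rewrite Rmult_0_r.
  enough (1 <= INR M * (/ 2) ^ (S n * S (length t))) by lra.
  unfold M. rewrite INR_pow2, <- (half_pow (S n * S (length t))), Rmult_comm.
  apply Rmult_le_compat_r; [apply Rlt_le, half_pow_pos|]. apply Rle_pow; [lra|nia].
Qed.

Lemma collision_supermartingale X n l : supermartingale n (collision_risk X n l).
Proof.
  intros c [Iw _ _ _].
  assert (G := growth_collision X n l (width c) (stem c) Iw).
  destruct (next_spec n c) as
    [i' x Ew Eh|k i' x Ew Hk Hk1 Eh|k i' x Ew Hk _ _|Ew Eb|Ew Eb Et|i' Ew Eb Et Ep|i' Ew Eb Et E|i' Ew Eb Et _ _ _];
    try (rewrite rsum_const; apply Rle_refl).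
  - exact (G _ (walk_injective _ _ _ Eb)).
  - exact (G (fun v => v) ltac:(easy)).
  - rewrite (rsum_ext _ _ (fun _ => collision_risk X n l c)) by easy.
    rewrite rsum_const. apply Rle_refl.
Qed.

Lemma collision_risk_ge X n l c : collision X l c -> 1 <= collision_risk X n l c.
Proof.
  intros [L H]. unfold collision_risk. destruct (Nat.ltb_spec l (length (stem c))); [|lia].
  rewrite decide_true by easy. lra.
Qed.

Lemma collision_risk_nonneg X n l c : 0 <= collision_risk X n l c.
Proof.
  unfold collision_risk. pose proof (half_pow_pos (S n * S l)).
  destruct (_ <? _)%nat; [destruct decide|]; lra.
Qed.

Lemma collision_risk_start X n l : collision_risk X n l (fst (start n)) <= (/ 2) ^ (n + l + 1).
Proof. apply (half_pow_le (n + l + 1) (S n * S l)). nia. Qed.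

(** * The measure of the tests *)

Definition fair (M : list bool -> R) : Prop :=
  forall s, M (s ++ [true]) + M (s ++ [false]) <= 2 * M s.

Definition antichain (F : list (list bool)) : Prop :=
  forall s t, In s F -> In (s ++ t) F -> t = [].

Fixpoint weight (M : list bool -> R) (F : list (list bool)) : R :=
  match F with
  | [] => 0
  | s :: F' => (/ 2) ^ length s * M s + weight M F'
  end.

Fixpoint below (b : bool) (F : list (list bool)) : list (list bool) :=
  match F with
  | [] => []
  | [] :: F' => below b F'
  | (x :: s) :: F' => if Bool.eqb x b then s :: below b F' else below b F'
  end.

Lemma below_In b s F : In s (below b F) <-> In (b :: s) F.
Proof.
  induction F as [|[|x t] F IH]; cbn; [easy|rewrite IH; intuition congruence|].
  destruct (Bool.eqb x b) eqn:E.
  - apply eqb_prop in E. subst x. cbn. rewrite IH. intuition congruence.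
  - rewrite IH. split; [now right|]. intros [E'|I]; [|easy].
    injection E' as -> _. now rewrite eqb_reflx in E.
Qed.

Lemma below_NoDup b F : NoDup F -> NoDup (below b F).
Proof.
  induction 1 as [|[|x t] F N ND IH]; cbn; [constructor|easy|].
  destruct (Bool.eqb x b) eqn:E; [|easy]. apply eqb_prop in E. subst x.
  constructor; [|easy]. now rewrite below_In.
Qed.

Lemma weight_below M F : ~ In [] F ->
  weight M F = / 2 * weight (fun s => M (true :: s)) (below true F)
             + / 2 * weight (fun s => M (false :: s)) (below false F).
Proof.
  induction F as [|[|x t] F IH]; intro N; cbn.
  - lra.
  - destruct N. now left.
  - rewrite IH by (intro I; apply N; now right). destruct x; cbn; lra.
Qed.

Lemma kraft M F : fair M -> (forall s, 0 <= M s) -> NoDup F -> antichain F ->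
  weight M F <= M [].
Proof.
  intros HM H0 ND A.
  remember (list_max (map (@length bool) F)) as n eqn:En.
  assert (L : forall s, In s F -> (length s <= n)%nat).
  { intros s I. subst n. pose proof (proj1 (list_max_le (map (@length bool) F) _) (le_n _)) as G.
    rewrite Forall_forall in G. apply G. now apply in_map. }
  clear En. revert M F HM H0 ND A L. induction n as [|n IH]; intros M F HM H0 ND A L.
  all: destruct (in_dec (list_eq_dec Bool.bool_dec) [] F) as [I|N].
  1, 3: assert (forall s, In s F -> s = []) as E by (intros s Hs; now apply (A [] s));
    destruct F as [|s [|t F]]; [cbn; apply H0| |];
    [rewrite (E s) by (now left); cbn; lra|];
    exfalso; inversion_clear ND as [|? ? N _]; apply N; left;
    rewrite (E s), (E t); cbn; auto.
  - destruct F as [|s F]; [cbn; apply H0|]. specialize (L s ltac:(now left)).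
    destruct s; [|cbn in L; lia]. destruct N. now left.
  - rewrite weight_below by easy.
    assert (B : forall b, weight (fun s => M (b :: s)) (below b F) <= M [b]).
    { intro b. apply IH.
      - intro s. apply (HM (b :: s)).
      - intro s. apply H0.
      - now apply below_NoDup.
      - intros s t Hs Ht. apply below_In in Hs, Ht. now apply (A (b :: s) t).
      - intros s Hs. apply below_In in Hs. specialize (L _ Hs). cbn in L. lia. }
    pose proof (B true). pose proof (B false). pose proof (HM []) as HM0. cbn in HM0. lra.
Qed.

Lemma weight_le M M' F : (forall s, In s F -> M s <= M' s) -> weight M F <= weight M' F.
Proof.
  induction F as [|s F IH]; intro H; cbn; [lra|].
  apply Rplus_le_compat; [|apply IH; intros; apply H; now right].
  apply Rmult_le_compat_l; [apply Rlt_le, half_pow_pos|]. apply H. now left.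
Qed.

Lemma string_code_inj s t : string_code s = string_code t -> s = t.
Proof.
  revert t. induction s as [|b s IH]; intros [|b' t]; cbn; intro E; try easy;
    try (destruct b; lia); try (destruct b'; lia).
  destruct b, b'; try lia; f_equal; apply IH; lia.
Qed.

Definition minimal (W : list bool -> Prop) (s : list bool) : Prop :=
  W s /\ forall t u, s = t ++ u -> W t -> u = [].

Lemma minimal_prefix W s : W s -> exists t u, s = t ++ u /\ minimal W t.
Proof.
  remember (length s) as n eqn:En. revert s En.
  induction n as [n IH] using lt_wf_ind; intros s En Hs.
  destruct (excluded_middle_informative (minimal W s)) as [H|H].
  { exists s, []. now rewrite app_nil_r. }
  assert (K : exists t u, s = t ++ u /\ W t /\ u <> []).
  { apply NNPP. intro K. apply H. split; [easy|]. intros t u E Ht.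
    apply NNPP. intro U. apply K. now exists t, u. }
  destruct K as (t & u & E & Ht & U).
  destruct (IH (length t)) with (s := t) as (t' & u' & E' & Hm); try easy.
  { subst. rewrite length_app. destruct u; [easy|cbn; lia]. }
  exists t', (u' ++ u). split; [|easy]. subst. now rewrite app_assoc.
Qed.

(** Codes of no minimal string get a dummy of negligible mass, since a cover is
    indexed by all natural numbers. *)
Definition cover (W : list bool -> Prop) (N k : nat) : list bool :=
  match excluded_middle_informative (exists s, string_code s = k /\ minimal W s) with
  | left H => proj1_sig (constructive_indefinite_description _ H)
  | right _ => repeat false (k + N)
  end.

Lemma cover_minimal W N s : minimal W s -> cover W N (string_code s) = s.
Proof.
  intro H. unfold cover. destruct excluded_middle_informative as [E|E].
  - destruct constructive_indefinite_description as (t & Et & Mt); cbn.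
    now apply string_code_inj.
  - destruct E. now exists s.
Qed.

Lemma geometric_tail N m : rsum m (fun k => (/ 2) ^ (k + N)) <= 2 * (/ 2) ^ N - 2 * (/ 2) ^ (m + N).
Proof. induction m as [|m IH]; cbn [rsum Nat.add pow]; lra. Qed.

Lemma cover_partial W N m : exists F, NoDup F /\
  (forall s, In s F -> minimal W s /\ (string_code s < m)%nat) /\
  rsum m (fun k => (/ 2) ^ length (cover W N k)) <=
  weight (fun _ => 1) F + rsum m (fun k => (/ 2) ^ (k + N)).
Proof.
  induction m as [|m (F & ND & HF & SF)].
  { exists []. split; [constructor|]. split; [easy|]. cbn. lra. }
  cbn [rsum]. unfold cover at 2. destruct excluded_middle_informative as [E|E].
  - destruct constructive_indefinite_description as (s & Es & Hs); cbn.
    exists (s :: F). split; [constructor|split].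
    + intro I. apply HF in I. lia.
    + easy.
    + intros t [<-|I]; [split; [easy|lia]|]. apply HF in I. split; [easy|lia].
    + cbn. pose proof (half_pow_pos (m + N)). lra.
  - exists F. split; [easy|]. split.
    + intros s I. apply HF in I. split; [easy|lia].
    + rewrite repeat_length. lra.
Qed.

Lemma sum_n_rsum (a : nat -> R) m : sum_n a m = rsum (S m) a.
Proof.
  induction m as [|m IH].
  - rewrite sum_O. cbn. lra.
  - rewrite sum_Sn, IH. reflexivity.
Qed.

Lemma half_pow_small eps : 0 < eps -> exists N, (/ 2) ^ N < eps.
Proof.
  intro H. destruct (pow_lt_1_zero (/ 2)) with (y := eps) as [N HN]; [|easy|].
  - rewrite Rabs_pos_eq; lra.
  - exists N. specialize (HN N (le_n N)). rewrite Rabs_pos_eq in HN; [easy|].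
    apply Rlt_le, half_pow_pos.
Qed.

Lemma measure_open_le (W : list bool -> Prop) (eps : R) :
  (forall F, NoDup F -> antichain F -> (forall s, In s F -> W s) -> weight (fun _ => 1) F <= eps) ->
  Rbar_le (measure (open_class W)) eps.
Proof.
  intro HW.
  assert (K : forall N, exists r, r <= eps + 2 * (/ 2) ^ N /\
    exists s : nat -> list bool, (forall Z, open_class W Z -> exists k, cylinder (s k) Z) /\
      is_series (fun k => ((/ 2) ^ length (s k))%R) r).
  { intro N.
    assert (B : forall m, sum_n (fun k => (/ 2) ^ length (cover W N k)) m <= eps + 2 * (/ 2) ^ N).
    { intro m. rewrite sum_n_rsum. destruct (cover_partial W N (S m)) as (F & ND & HF & SF).
      assert (weight (fun _ => 1) F <= eps).
      { apply HW; [easy| |intros s I; now apply HF].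
        intros s t Hs Ht. apply HF in Hs, Ht.
        destruct Hs as [[Ws _] _], Ht as [[_ Mt] _]. now apply (Mt s t). }
      pose proof (geometric_tail N (Datatypes.S m)).
      pose proof (half_pow_pos (Datatypes.S m + N)). lra. }
    destruct (ex_finite_lim_seq_incr (sum_n (fun k => (/ 2) ^ length (cover W N k)))
      (eps + 2 * (/ 2) ^ N)) as [r Hr].
    { intro m. rewrite sum_Sn. unfold plus; cbn.
      pose proof (half_pow_pos (length (cover W N (S m)))). lra. }
    { exact B. }
    exists r. split.
    - exact (is_lim_seq_le _ _ _ _ B Hr (is_lim_seq_const _)).
    - exists (cover W N). split; [|exact Hr].
      intros Z (s & Hs & Cs). destruct (minimal_prefix W s Hs) as (t & u & -> & Ht).
      exists (string_code t). rewrite cover_minimal by easy.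
      unfold cylinder in *. rewrite length_app, seq_app, map_app in Cs.
      assert (E : firstn (length t) (map Z (seq 0 (length t)) ++ map Z (seq (0 + length t) (length u)))
        = firstn (length t) (t ++ u)) by now rewrite Cs.
      rewrite !firstn_app, firstn_all in E.
      rewrite firstn_all2 in E by (rewrite length_map, length_seq; lia).
      rewrite length_map, length_seq, Nat.sub_diag in E. cbn in E.
      now rewrite !app_nil_r in E. }
  unfold measure. destruct (Glb_Rbar_correct (fun r => exists s : nat -> list bool,
    (forall Z, open_class W Z -> exists k, cylinder (s k) Z) /\
    is_series (fun k => ((/ 2) ^ length (s k))%R) r)) as [LB _].
  destruct (Glb_Rbar _) as [g| |]; cbn; [|destruct (K 0%nat) as (r & _ & Hr); exact (LB r Hr)|easy].
  apply Rnot_lt_le. intro L. destruct (half_pow_small ((g - eps) / 2)) as [N HN]; [lra|].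
  destruct (K N) as (r & Lr & Hr). specialize (LB r Hr). cbn in LB. lra.
Qed.

Definition avg (n : nat) (V : core -> R) (c : core) (v r : nat) : R :=
  (/ 2) ^ r * rsum (2 ^ r) (fun w => V (next n c (v * 2 ^ r + w)%nat)).

Lemma avg_S n V c v r :
  2 * avg n V c v (S r) = avg n V c (2 * v + 1) r + avg n V c (2 * v) r.
Proof.
  unfold avg. replace (2 ^ S r)%nat with (2 ^ r + 2 ^ r)%nat by (cbn; lia).
  rewrite rsum_split. cbn [pow].
  rewrite (rsum_ext _ (fun w => V (next n c (v * (2 ^ r + 2 ^ r) + w)%nat))
    (fun w => V (next n c (2 * v * 2 ^ r + w)%nat))) by (intros; f_equal; f_equal; lia).
  rewrite (rsum_ext _ (fun w => V (next n c (v * (2 ^ r + 2 ^ r) + (2 ^ r + w))%nat))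
    (fun w => V (next n c ((2 * v + 1) * 2 ^ r + w)%nat))) by (intros; f_equal; f_equal; lia).
  lra.
Qed.

Lemma avg_0 n V c v : avg n V c v 0 = V (next n c v).
Proof. unfold avg. cbn. rewrite Nat.mul_1_r, Nat.add_0_r. lra. Qed.

Record reader_inv (n : nat) (r : reader) : Prop := {
  reader_core : inv n (fst r);
  reader_count : (snd (snd r) < need n (fst r))%nat;
  reader_fresh : snd (snd r) = 0%nat -> fst (snd r) = 0%nat }.

Lemma reader_inv_start n : reader_inv n (start n).
Proof.
  split; [apply inv_start|apply need_pos, inv_start|easy].
Qed.

Lemma reader_inv_read n r b : reader_inv n r -> reader_inv n (read n r b).
Proof.
  intros [I C _]. unfold read. destruct (Nat.ltb_spec (S (snd (snd r))) (need n (fst r))); split;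
    cbn [fst snd]; try easy.
  - now apply inv_next.
  - now apply need_pos, inv_next.
Qed.

Lemma run_app n s t : run n (s ++ t) = fold_left (read n) t (run n s).
Proof. unfold run. apply fold_left_app. Qed.

Lemma reader_inv_run n s : reader_inv n (run n s).
Proof.
  induction s as [|b s IH] using rev_ind; [apply reader_inv_start|].
  rewrite run_app. now apply reader_inv_read.
Qed.

Definition potential (n : nat) (V : core -> R) (r : reader) : R :=
  if (snd (snd r) =? 0)%nat then V (fst r)
  else avg n V (fst r) (fst (snd r)) (need n (fst r) - snd (snd r)).

Lemma potential_fair n V : supermartingale n V -> fair (fun s => potential n V (run n s)).
Proof.
  intros HV s. rewrite !run_app. cbn [fold_left].
  destruct (reader_inv_run n s) as [I C Fr]. destruct (run n s) as [c [v k]]. cbn [fst snd] in *.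
  assert (P : avg n V c v (need n c - k) <= potential n V (c, (v, k))).
  { unfold potential. cbn [fst snd]. destruct (Nat.eqb_spec k 0) as [->|]; [|lra].
    rewrite Nat.sub_0_r, Fr by easy. unfold avg. cbn [Nat.mul Nat.add].
    pose proof (HV c I) as H. rewrite INR_pow2 in H.
    apply (Rmult_le_compat_l ((/ 2) ^ need n c)) in H; [|apply Rlt_le, half_pow_pos].
    rewrite <- Rmult_assoc, half_pow in H. lra. }
  assert (R : forall b, potential n V (read n (c, (v, k)) b) =
    avg n V c (2 * v + Nat.b2n b) (need n c - k - 1)).
  { intro b. unfold read. cbn [fst snd]. destruct (Nat.ltb_spec (S k) (need n c)).
    - unfold potential. cbn [fst snd]. cbn [Nat.eqb]. f_equal. lia.
    - replace (need n c - k - 1)%nat with 0%nat by lia. now rewrite avg_0. }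
  rewrite !R. cbn [Nat.b2n].
  replace (need n c - k)%nat with (S (need n c - k - 1)) in P by lia.
  rewrite Nat.add_0_r, <- avg_S. lra.
Qed.

Lemma rsum_nonneg n F : (forall v, 0 <= F v) -> 0 <= rsum n F.
Proof. intro H. induction n as [|n IH]; cbn; [lra|]. specialize (H n). lra. Qed.

Lemma potential_nonneg n V r : (forall c, 0 <= V c) -> 0 <= potential n V r.
Proof.
  intro H. unfold potential. destruct (_ =? _)%nat; [easy|].
  apply Rmult_le_pos; [apply Rlt_le, half_pow_pos|]. now apply rsum_nonneg.
Qed.

Lemma fair_rsum N (M : nat -> list bool -> R) :
  (forall i, fair (M i)) -> fair (fun s => rsum N (fun i => M i s)).
Proof.
  intros H s. rewrite <- rsum_plus, <- rsum_scal. apply rsum_le. intros i _. apply H.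
Qed.

Lemma rsum_term N F i : (forall v, 0 <= F v) -> (i < N)%nat -> F i <= rsum N F.
Proof.
  intros H. induction N as [|N IH]; intro L; [lia|]. cbn.
  pose proof (rsum_nonneg N F H). pose proof (H N).
  destruct (Nat.eq_dec i N) as [->|]; [lra|]. specialize (IH ltac:(lia)). lra.
Qed.

(** The union over [m] puts a sequence outside some level outside the failures of
    all but finitely many of the processes. *)
Definition test (bad : nat -> nat -> core -> Prop) (n : nat) (s : list bool) : Prop :=
  exists m i, snd (snd (run (n + m + 1) s)) = 0%nat /\
    bad (n + m + 1)%nat i (fst (run (n + m + 1) s)).

Lemma test_measure (bad : nat -> nat -> core -> Prop) (V : nat -> nat -> core -> R) n :
  (forall n i, supermartingale n (V n i)) ->
  (forall n i c, 0 <= V n i c) ->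
  (forall n i c, inv n c -> bad n i c -> 1 <= V n i c) ->
  (forall n i, V n i (fst (start n)) <= (/ 2) ^ (n + i + 1)) ->
  Rbar_le (measure (open_class (test bad n))) ((/ 2) ^ n).
Proof.
  intros HV H0 Hb Hs. apply measure_open_le. intros F ND A HF.
  assert (B : exists N, forall s, In s F -> exists m i, (m < N)%nat /\ (i < N)%nat /\
    snd (snd (run (n + m + 1) s)) = 0%nat /\
    bad (n + m + 1)%nat i (fst (run (n + m + 1) s))).
  { clear ND A. induction F as [|s F IH]; [now exists 0%nat|].
    destruct IH as [N HN]; [intros; apply HF; now right|].
    destruct (HF s ltac:(now left)) as (m & i & H).
    exists (N + S m + S i)%nat. intros t [<-|I].
    - exists m, i. repeat split; try lia; apply H.
    - destruct (HN t I) as (m' & i' & Lm & Li & H'). exists m', i'. repeat split; try lia; apply H'. }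
  destruct B as [N HN].
  set (M := fun m i s => potential (n + m + 1) (V (n + m + 1)%nat i) (run (n + m + 1) s)).
  set (T := fun s => rsum N (fun m => rsum N (fun i => M m i s))).
  assert (M0 : forall m i s, 0 <= M m i s) by (intros; now apply potential_nonneg).
  assert (T0 : forall s, 0 <= T s) by (intro; apply rsum_nonneg; intro; now apply rsum_nonneg).
  eapply Rle_trans; [apply (weight_le _ T)|].
  { intros s I. destruct (HN s I) as (m & i & Lm & Li & Ek & Hbad).
    apply Rle_trans with (M m i s).
    - unfold M, potential. rewrite Ek. apply Hb; [|easy]. apply reader_inv_run.
    - eapply Rle_trans; [|apply (rsum_term N (fun m => rsum N (fun i => M m i s)) m)]; [|intro; now apply rsum_nonneg|easy].
      cbv beta. now apply (rsum_term N (fun i => M m i s)). }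
  eapply Rle_trans; [apply kraft|]; try easy.
  { apply (fair_rsum N (fun m s => rsum N (fun i => M m i s))). intro m.
    apply (fair_rsum N (fun i s => M m i s)). intro i. now apply potential_fair. }
  unfold T. apply Rle_trans with (rsum N (fun m => (/ 2) ^ (m + (n + 1)))).
  - apply rsum_le. intros m _.
    apply Rle_trans with (rsum N (fun i => (/ 2) ^ (i + (m + (n + 1) + 1)))).
    + apply rsum_le. intros i _.
      replace (i + (m + (n + 1) + 1))%nat with (n + m + 1 + i + 1)%nat by lia. apply Hs.
    + eapply Rle_trans; [apply geometric_tail|].
      pose proof (half_pow_pos (N + (m + (n + 1) + 1))).
      rewrite (pow_add _ (m + (n + 1)) 1). lra.
  - eapply Rle_trans; [apply geometric_tail|].
    pose proof (half_pow_pos (N + (n + 1))). rewrite (pow_add _ n 1). lra.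
Qed.

(** * The outcome of a successful run *)

Local Open Scope nat_scope.

Lemma comp_string_code {O A} `{Enc A} (s : A -> list bool) :
  effective O s -> effective O (fun x => string_code (s x)).
Proof.
  intro Hs. apply (comp_ext (fun x =>
    fold_right (fun (b : bool) a => 2 * a + (if b then 2 else 1)) 0 (s x))).
  { intro x. induction (s x) as [|b t IH]; cbn [fold_right string_code]; now rewrite ?IH. }
  cmp.
Qed.
#[export] Hint Extern 1 (effective _ (fun x => string_code _)) => apply comp_string_code : cmp.

Definition bits (l : list nat) : list bool := map (fun x => negb (x =? 0)) l.

Lemma bits_onto s : bits (map Nat.b2n s) = s.
Proof. unfold bits. induction s as [|[] s IH]; cbn; congruence. Qed.

Lemma comp_bits {O A} `{Enc A}
  (l : A -> list nat) : effective O l -> effective O (fun x => bits (l x)).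
Proof. intros. unfold bits. cmp. Qed.
#[export] Hint Extern 1 (effective _ (fun x => bits _)) => apply comp_bits : cmp.

Lemma test_ce {O W} `{Onto W} (bad : nat -> nat -> core -> Prop)
  (chk : nat * (nat * core) -> W -> bool) :
  effective O (fun p : (nat * (nat * core)) * W => chk (fst p) (snd p)) ->
  (forall n i c, bad n i c <-> exists w, chk (n, (i, c)) w = true) ->
  uniformly_ce O (test bad).
Proof.
  intros Hchk Hbad.
  destruct (search_code (O := O) (fun (a : nat * nat) (w : nat * (nat * (list nat * W))) =>
    (string_code (bits (fst (snd (snd w)))) =? snd a) &&
    ((snd (snd (run (fst a + fst w + 1) (bits (fst (snd (snd w)))))) =? 0) &&
     chk (fst a + fst w + 1, (fst (snd w), fst (run (fst a + fst w + 1) (bits (fst (snd (snd w)))))))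
       (snd (snd (snd w))))) (fun _ _ => 0)) as [c Hc].
  { apply comp_andb; [cmp|]. apply comp_andb; [cmp|]. apply (comp_app2 chk); [easy|cmp..]. }
  { cmp. }
  exists (encode c). intros n s. split.
  - intros (m & i & Ek & B). apply Hbad in B. destruct B as [w Hw].
    destruct (proj1 (Hc (n, string_code s)) (m, (i, (map Nat.b2n s, w)))) as (_ & _ & E).
    { cbn [fst snd]. rewrite bits_onto, Nat.eqb_refl, Ek. exact Hw. }
    eexists. exists c. split; [easy|]. apply E.
  - intros (y & c' & E & Hy). apply encode_inj in E. subst c'.
    destruct (proj2 (Hc (n, string_code s)) y Hy) as ([m [i [l w]]] & Hw).
    cbn [fst snd] in Hw. rewrite !andb_true_iff, !Nat.eqb_eq in Hw.
    destruct Hw as (Es & Ek & Hw). apply string_code_inj in Es. subst s.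
    exists m, i. split; [easy|]. apply Hbad. now exists w.
Qed.

Lemma collision_ce X : uniformly_ce (char X) (test (fun _ => collision X)).
Proof.
  apply (test_ce _ (fun (a : nat * (nat * core)) (D : triples) =>
    (fst (snd a) <? length (stem (snd (snd a)))) &&
    derives (fun u v => v =? char X u) D (fst (snd a)) (fst (snd a))
      (nth (fst (snd a)) (stem (snd (snd a))) 0))).
  - assert (Q : effective (char X) (fun p : ((nat * (nat * core)) * triples) * (nat * nat) =>
      snd (snd p) =? char X (fst (snd p)))) by (apply comp_eqb; [|apply comp_query]; cmp).
    apply comp_andb; [cmp|]. apply (comp_derives (fun _ u v => v =? char X u)); [exact Q|cmp..].
  - intros n l c. cbn [fst snd]. unfold collision. rewrite phi_derives. split.
    + intros [L [D HD]]. exists D. rewrite andb_true_iff, Nat.ltb_lt. easy.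
    + intros [D HD]. rewrite andb_true_iff, Nat.ltb_lt in HD. split; [easy|]. now exists D.
Qed.

Lemma comp_wait_for {O A} `{Enc A} (i : A -> nat) (c : A -> core) :
  effective O i -> effective O c -> effective O (fun x => wait_for (i x) (c x)).
Proof. intros. unfold wait_for. cmp. Qed.
#[export] Hint Extern 1 (effective _ (fun x => wait_for _ _)) => apply comp_wait_for : cmp.

Lemma not_avoided_iff i s t : ~ avoided i s t <->
  exists w, bigb (functional i) (prog s) (seq 0 (cap s)) (at_width s + cap s) t w = true.
Proof.
  unfold avoided. split.
  - intro N. apply NNPP in N. apply big_bigb. eapply big_ext; [|apply N].
    intros u (v & L & Hv). exists v. split; [apply in_seq; lia|easy].
  - intros [w Hw] N. apply N. apply bigb_big in Hw. eapply big_ext; [|apply Hw].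
    intros u (v & L & Hv). apply in_seq in L. exists v. split; [lia|easy].
Qed.

Lemma broken_ce : uniformly_ce (char (jump empty)) (test broken).
Proof.
  destruct (jump_decides (fun (a : nat * nat) x => halts_by (fst a) (snd a) x)) as (dh & Hh & Eh);
    [cmp|].
  destruct (jump_decides (fun (a : nat * status) x => hit_by (functional (fst a))
    (prog (snd a)) (at_width (snd a)) (at_stem (snd a)) x)) as (dx & Hx & Ex);
    [unfold functional; cmp|].
  destruct (jump_decides (fun (a : nat * (status * list nat)) w =>
    bigb (functional (fst a)) (prog (fst (snd a))) (seq 0 (cap (fst (snd a))))
      (at_width (fst (snd a)) + cap (fst (snd a))) (snd (snd a)) w)) as (db & Hb & Eb);
    [unfold functional; cmp|].
  apply (test_ce _ (fun (a : nat * (nat * core)) (_ : nat) =>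
    let n := fst a in let i := fst (snd a) in let c := snd (snd a) in
    let s := look i (log c) in
    (wait_for i c =? 1) && negb (dh (bounding i, prog s)) ||
    (2 <=? wait_for i c) && negb (dx (i, s)) ||
    (phase s =? 0) && (limit_tries n i <=? tries s) ||
    (phase s =? 2) && (negb (dx (i, s)) && db (i, (s, stem c))))).
  - cbv zeta. unfold bounding, limit_tries, hazard. cmp.
  - intros n i c. cbv zeta. cbn [fst snd].
    assert (Eh' : dh (bounding i, prog (look i (log c))) = true <->
      halts (bounding i) (prog (look i (log c)))).
    { rewrite Eh. cbn [fst snd]. split.
      - intros [w Hw]. eexists. eapply halts_by_phi, Hw.
      - intro Hw. destruct (halts_halts_by _ _ 0 Hw) as (x & _ & Hx'). now exists x. }
    assert (Ex' : dx (i, look i (log c)) = true <-> hit_at i (look i (log c))).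
    { rewrite Ex. cbn [fst snd]. split.
      - intros [w Hw]. eapply hit_by_hit, Hw.
      - intro Hw. destruct (hit_hit_by _ _ _ _ 0 Hw) as (x & _ & Hx'). now exists x. }
    assert (Eb' : db (i, (look i (log c), stem c)) = true <->
      ~ avoided i (look i (log c)) (stem c)).
    { rewrite Eb, not_avoided_iff. easy. }
    unfold broken. rewrite <- Eb', <- Ex', <- Eh'.
    transitivity ((wait_for i c =? 1) && negb (dh (bounding i, prog (look i (log c)))) ||
      (2 <=? wait_for i c) && negb (dx (i, look i (log c))) ||
      (phase (look i (log c)) =? 0) && (limit_tries n i <=? tries (look i (log c))) ||
      (phase (look i (log c)) =? 2) && (negb (dx (i, look i (log c))) &&
        db (i, (look i (log c), stem c))) = true).
    + rewrite !orb_true_iff, !andb_true_iff, !negb_true_iff, !Nat.eqb_eq, !Nat.leb_le,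
        <- !not_true_iff_false. tauto.
    + split; [now exists 0|now intros [_ E]].
Qed.

Lemma broken_test : ML_test (char (jump empty)) (test broken).
Proof.
  split; [apply broken_ce|]. intro n. apply (test_measure _ requirement_risk).
  - apply requirement_supermartingale.
  - apply risk_nonneg.
  - apply broken_risk.
  - apply risk_start.
Qed.

Lemma collision_test X : ML_test (char X) (test (fun _ => collision X)).
Proof.
  split; [apply collision_ce|]. intro n. apply (test_measure _ (collision_risk X)).
  - apply collision_supermartingale.
  - apply collision_risk_nonneg.
  - intros. now apply collision_risk_ge.
  - apply collision_risk_start.
Qed.

Definition initial (Z : binseq) (t : nat) : list bool := map Z (seq 0 t).

Lemma initial_cylinder Z t : cylinder (initial Z t) Z.
Proof. unfold cylinder, initial. now rewrite length_map, length_seq. Qed.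

Lemma random_passes X Z : ML_random X Z -> two_random Z ->
  exists n, forall t, snd (snd (run n (initial Z t))) = 0 ->
    forall i, ~ broken n i (fst (run n (initial Z t))) /\
      ~ collision X i (fst (run n (initial Z t))).
Proof.
  intros HX H2.
  specialize (H2 _ broken_test). apply not_all_ex_not in H2. destruct H2 as [n1 N1].
  specialize (HX _ (collision_test X)). apply not_all_ex_not in HX. destruct HX as [n2 N2].
  exists (n1 + n2 + 1). intros t Ht i. split; intro B.
  - apply N1. exists (initial Z t). split; [|apply initial_cylinder]. now exists n2, i.
  - apply N2. exists (initial Z t). split; [|apply initial_cylinder]. exists n1, i.
    now rewrite (Nat.add_comm n2 n1).
Qed.

Definition at_time (n : nat) (Z : binseq) (t : nat) : core := fst (run n (initial Z t)).

Lemma initial_S Z t : initial Z (S t) = initial Z t ++ [Z t].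
Proof. unfold initial. now rewrite seq_S, map_app. Qed.

Lemma run_S n Z t : run n (initial Z (S t)) = read n (run n (initial Z t)) (Z t).
Proof. now rewrite initial_S, run_app. Qed.

Lemma next_stem n c v : exists u, stem (next n c v) = stem c ++ u.
Proof.
  destruct (next_spec n c); cbn [stem]; try (exists []; now rewrite app_nil_r); now eexists.
Qed.

Lemma at_time_stem
  n Z t t' : t <= t' -> exists u, stem (at_time n Z t') = stem (at_time n Z t) ++ u.
Proof.
  induction 1 as [|t' _ [u E]]; [exists []; now rewrite app_nil_r|].
  unfold at_time in *. rewrite run_S. unfold read.
  destruct (_ <? _); cbn [fst]; [now exists u|].
  match goal with |- context [next ?n ?c ?v] => destruct (next_stem n c v) as [u' ->] end.
  rewrite E. exists (u ++ u'). now rewrite app_assoc.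
Qed.

Lemma at_time_nth n Z t t' l :
  l < length (stem (at_time n Z t)) -> l < length (stem (at_time n Z t')) ->
  nth l (stem (at_time n Z t)) 0 = nth l (stem (at_time n Z t')) 0.
Proof.
  intros L L'. destruct (Nat.le_ge_cases t t') as [T|T];
    destruct (at_time_stem n Z _ _ T) as [u ->]; now rewrite app_nth1.
Qed.

Definition advances (n : nat) (Z : binseq) (t t' : nat) : Prop := exists v,
  v < 2 ^ need n (at_time n Z t) /\
  run n (initial Z t') = (next n (at_time n Z t) v, (0, 0)).

Lemma block n Z t : snd (run n (initial Z t)) = (0, 0) ->
  exists t', advances n Z t t'.
Proof.
  intro E. unfold advances, at_time. pose proof (reader_inv_run n (initial Z t)) as [_ C _].
  destruct (run n (initial Z t)) as [c [a b]] eqn:ER. cbn [fst snd] in *. injection E as -> ->.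
  assert (K : forall k, k < need n c -> exists v, v < 2 ^ k /\
    run n (initial Z (k + t)) = (c, (v, k))).
  { induction k as [|k IH]; intro L; [exists 0; split; [apply le_n|exact ER]|].
    destruct IH as (v & Lv & Ek); [lia|]. exists (2 * v + Nat.b2n (Z (k + t))). split.
    - cbn [Nat.pow]. destruct (Z (k + t)); cbn; lia.
    - cbn [Nat.add]. rewrite run_S, Ek. unfold read. cbn [fst snd].
      now apply Nat.ltb_lt in L as ->. }
  destruct (need n c) as [|k] eqn:En; [lia|]. destruct (K k) as (v & Lv & Ek); [lia|].
  exists (S (k + t)), (2 * v + Nat.b2n (Z (k + t))). split.
  - cbn [Nat.pow]. destruct (Z (k + t)); cbn; lia.
  - rewrite run_S, Ek. unfold read. cbn [fst snd]. rewrite En, Nat.ltb_irrefl. reflexivity.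
Qed.

Fixpoint block_time (n : nat) (Z : binseq) (k : nat) : nat :=
  match k with
  | 0 => 0
  | S k' => epsilon (inhabits 0) (advances n Z (block_time n Z k'))
  end.

Definition state (n : nat) (Z : binseq) (k : nat) : core := at_time n Z (block_time n Z k).

Lemma block_time_fresh n Z k : snd (run n (initial Z (block_time n Z k))) = (0, 0).
Proof.
  induction k as [|k IH]; [easy|].
  destruct (epsilon_spec (inhabits 0) _ (block n Z _ IH)) as (v & _ & E).
  cbn [block_time]. now rewrite E.
Qed.

Lemma state_S n Z k : exists m g v, next_case n (state n Z k) m g /\ v < 2 ^ m /\
  state n Z (S k) = g v.
Proof.
  destruct (epsilon_spec (inhabits 0) _ (block n Z _ (block_time_fresh n Z k))) as (v & L & E).
  exists (need n (state n Z k)), (next n (state n Z k)), v. split; [apply next_spec|].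
  split; [easy|]. unfold state at 1, at_time at 1. cbn [block_time]. now rewrite E.
Qed.

Lemma state_inv n Z k : inv n (state n Z k).
Proof. apply reader_inv_run. Qed.

Section Outcome.
Context (n : nat) (Z : binseq).
Context (unbroken : forall k i, ~ broken n i (state n Z k)).
Local Notation c := (state n Z).

Definition normal (d : core) : Prop :=
  fst (wait d) = 0 /\ bushy (width d) (path d) (stem d) = false.

Lemma wait_ends k d kk i x : wait (c k) = (kk, (i, x)) -> kk <> 0 ->
  (kk = 1 -> halts_by (bounding i) (prog (look i (log (c k)))) (x + d) = true) ->
  (kk <> 1 -> hit_by (functional i) (prog (look i (log (c k)))) (width (c k)) (stem (c k)) (x + d) = true) ->
  exists k', k <= k' /\ fst (wait (c k')) = 0 /\ clock (c k') = clock (c k).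
Proof.
  revert k x. induction d as [|d IH]; intros k x Ew Hk H1 H2;
    destruct (state_S n Z k) as (m & g & v & [i' x' Ew' Eh|k' i' x' Ew' Hk' Hk1 Eh|k' i' x' Ew' Hk' N1 N2
      |Ew' _|Ew' _ _|i' Ew' _ _ _|i' Ew' _ _ _|i' Ew' _ _ _ _ _] & _ & E);
    try (rewrite Ew in Ew'; cbn in Ew'; easy);
    rewrite Ew in Ew'; (injection Ew' as <- <- <- || injection Ew' as -> <- <-);
    try (exists (S k); rewrite E; split; [lia|easy]).
  - exfalso. rewrite Nat.add_0_r in *. destruct (Nat.eq_dec kk 1) as [->|K1].
    + rewrite N1 in H1 by easy. now specialize (H1 eq_refl).
    + rewrite N2 in H2 by easy. now specialize (H2 K1).
  - destruct (IH (S k) (S x)) as (k' & L & I & C).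
    + now rewrite E.
    + easy.
    + rewrite E. cbn [log]. now rewrite Nat.add_succ_comm.
    + rewrite E. cbn [log width stem]. now rewrite Nat.add_succ_comm.
    + exists k'. rewrite C, E. split; [lia|easy].
Qed.

Lemma becomes_idle k : exists k', k <= k' /\ fst (wait (c k')) = 0 /\ clock (c k') = clock (c k).
Proof.
  destruct (wait (c k)) as [kk [i x]] eqn:Ew.
  destruct (Nat.eq_dec kk 0) as [->|Hk].
  { exists k. now rewrite Ew. }
  pose proof (unbroken k i) as U. unfold broken, wait_for in U. rewrite Ew in U. cbn [fst snd] in U.
  rewrite Nat.eqb_refl in U.
  destruct (state_inv n Z k) as [_ _ _ Ix]. destruct (Ix _ _ _ Ew Hk) as (_ & S1 & W1).
  destruct (Nat.eq_dec kk 1) as [->|K1].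
  - assert (Hh : halts (bounding i) (prog (look i (log (c k))))).
    { apply NNPP. intro N. apply U. now left. }
    destruct (halts_halts_by _ _ x Hh) as (y & L & Hy).
    apply (wait_ends k (y - x) 1 i x Ew Hk); [|easy]. now replace (x + (y - x)) with y by lia.
  - assert (Hh : hit_at i (look i (log (c k)))).
    { apply NNPP. intro N. apply U. right. left. split; [lia|easy]. }
    unfold hit_at in Hh. rewrite S1, W1 in Hh.
    destruct (hit_hit_by _ _ _ _ x Hh) as (y & L & Hy).
    apply (wait_ends k (y - x) kk i x Ew Hk); [easy|]. now replace (x + (y - x)) with y by lia.
Qed.

Lemma walk_kid j p t v : bushy j p t = true -> v < 2 ^ (j * S (length t)) ->
  In (t ++ [nth v (kids p t) 0]) (snd p).
Proof.
  unfold bushy. rewrite Nat.leb_le. intros B L.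
  apply (kids_In p t). apply nth_In. lia.
Qed.

Lemma walk_step k : fst (wait (c k)) = 0 -> bushy (width (c k)) (path (c k)) (stem (c k)) = true ->
  exists v, In (stem (c k) ++ [v]) (snd (path (c k))) /\
    c (S k) = Core (stem (c k) ++ [v]) (width (c k)) (clock (c k)) (path (c k)) (wait (c k)) (log (c k)).
Proof.
  intros W B.
  destruct (state_S n Z k) as (m & g & v & [i' x' Ew' Eh|k' i' x' Ew' Hk' Hk1 Eh|k' i' x' Ew' Hk' N1 N2
      |Ew' B'|Ew' B' _|i' Ew' B' _ _|i' Ew' B' _ _|i' Ew' B' _ _ _ _] & L & E);
    try congruence; try (rewrite Ew' in W; cbn in W; congruence).
  eexists. split; [|exact E]. now apply (walk_kid (width (c k))).
Qed.

Lemma walk_ends k : fst (wait (c k)) = 0 ->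
  exists k', k <= k' /\ normal (c k') /\ clock (c k') = clock (c k).
Proof.
  remember (max_length (snd (path (c k))) - length (stem (c k))) as d eqn:Ed.
  revert k Ed. induction d as [d IH] using lt_wf_ind; intros k Ed W.
  destruct (bushy (width (c k)) (path (c k)) (stem (c k))) eqn:B.
  2:{ now exists k. }
  destruct (walk_step k W B) as (v & I & E).
  pose proof (max_length_In _ _ I) as L. rewrite length_app in L. cbn in L.
  destruct (IH (max_length (snd (path (c (S k)))) - length (stem (c (S k))))) with (k := S k)
    as (k' & L' & N & C); try easy.
  - rewrite E. cbn [path stem]. rewrite length_app. cbn. lia.
  - now rewrite E.
  - exists k'. split; [lia|]. split; [easy|]. now rewrite C, E.
Qed.

Lemma becomes_normal k : exists k', k <= k' /\ normal (c k') /\ clock (c k') = clock (c k).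
Proof.
  destruct (becomes_idle k) as (k1 & L1 & W & C1).
  destruct (walk_ends k1 W) as (k2 & L2 & N & C2).
  exists k2. split; [lia|]. split; [easy|congruence].
Qed.

Lemma normal_clock k : normal (c k) -> clock (c (S k)) = S (clock (c k)).
Proof.
  intros [W B].
  destruct (state_S n Z k) as (m & g & v & [i' x' Ew' Eh|k' i' x' Ew' Hk' Hk1 Eh|k' i' x' Ew' Hk' N1 N2
      |Ew' B'|Ew' B' _|i' Ew' B' _ _|i' Ew' B' _ _|i' Ew' B' _ _ _ _] & L & E);
    try congruence; try (rewrite Ew' in W; cbn in W; congruence); now rewrite E.
Qed.

Lemma clock_reaches
  k m : clock (c k) <= m -> exists k', k <= k' /\ normal (c k') /\ clock (c k') = m.
Proof.
  remember (m - clock (c k)) as d eqn:Ed. revert k Ed. induction d as [|d IH]; intros k Ed L.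
  - destruct (becomes_normal k) as (k' & L' & N & C). exists k'. split; [lia|]. split; [easy|lia].
  - destruct (becomes_normal k) as (k' & L' & N & C). pose proof (normal_clock _ N).
    destruct (IH (S k')) as (k'' & L'' & N'' & C''); [lia|lia|].
    exists k''. split; [lia|easy].
Qed.

Lemma visited k i x : clock (c k) <= x -> exists k', k <= k' /\ normal (c k') /\
  turn (c k') = i /\ snd (Cantor.of_nat (clock (c k'))) = x.
Proof.
  intro L. destruct (clock_reaches k (npair i x)) as (k' & L' & N & C).
  - pose proof (npair_le_r i x). lia.
  - exists k'. unfold turn. rewrite C, of_nat_npair. easy.
Qed.

Lemma state_stem k k' : k <= k' -> exists u, stem (c k') = stem (c k) ++ u.
Proof.
  induction 1 as [|k' _ [u E]]; [exists []; now rewrite app_nil_r|].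
  destruct (state_S n Z k') as (m & g & v & [] & _ & E'); rewrite E'; cbn [stem]; rewrite E;
    try (now exists u); rewrite <- app_assoc; now eexists.
Qed.

Lemma stem_unbounded L k : exists k', k <= k' /\ L <= length (stem (c k')).
Proof.
  induction L as [|L (k1 & L1 & IH)]; [exists k; lia|].
  destruct (visited k1 0 (clock (c k1)) (le_n _)) as (k2 & L2 & [W B] & T & _).
  destruct (state_S n Z k2) as (m & g & v & [i' x' Ew' Eh|k' i' x' Ew' Hk' Hk1 Eh|k' i' x' Ew' Hk' N1 N2
      |Ew' B'|Ew' B' _|i' Ew' B' T' _|i' Ew' B' T' _|i' Ew' B' T' _ _ _] & _ & E);
    try congruence; try (rewrite Ew' in W; cbn in W; congruence).
  exists (S k2). split; [lia|]. rewrite E. cbn [stem].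
  destruct (state_stem k1 k2 L2) as [u ->]. rewrite !length_app. cbn. lia.
Qed.

(** Ranks one attempt's phases in their order of occurrence. *)
Definition rank (s : status) : nat :=
  4 * tries s + match phase s with 1 => 0 | 2 => 1 | 0 => 2 | _ => 3 end.

Lemma rank_step i k : look i (log (c (S k))) = look i (log (c k)) \/
  rank (look i (log (c k))) < rank (look i (log (c (S k)))).
Proof.
  destruct (state_inv n Z k) as [_ _ _ Ix].
  destruct (state_S n Z k) as (m & g & v & [i' x' Ew Eh|k' i' x' Ew Hk Hk1 Eh|k' i' x' Ew Hk N1 N2
      |Ew B|Ew B _|i' Ew B T P|i' Ew B T P|i' Ew B T _ _ _] & _ & E);
    rewrite E; cbn [log]; try (now left); rewrite look_cons;
    (destruct (Nat.eqb_spec i' i) as [->|]; [right|now left]); unfold rank; cbn [tries phase].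
  - destruct (Ix _ _ _ Ew ltac:(easy)) as (-> & _). lia.
  - destruct (Ix _ _ _ Ew Hk) as (-> & _). lia.
  - rewrite P. lia.
  - destruct P as [[-> _]|[-> _]]; lia.
Qed.

Lemma tries_bounded i k : tries (look i (log (c k))) <= limit_tries n i.
Proof.
  induction k as [|k IH]; [apply Nat.le_0_l|].
  pose proof (unbroken k i) as U. unfold broken in U.
  destruct (state_S n Z k) as (m & g & v & [i' x' Ew Eh|k' i' x' Ew Hk Hk1 Eh|k' i' x' Ew Hk N1 N2
      |Ew B|Ew B _|i' Ew B T P|i' Ew B T P|i' Ew B T _ _ _] & _ & E);
    rewrite E; cbn [log]; try easy; rewrite look_cons;
    (destruct (Nat.eqb_spec i' i) as [->|]; [|easy]); cbn [tries]; try easy.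
  apply Nat.nlt_ge. intro L. apply U. right. right. left. split; [easy|lia].
Qed.

Lemma stabilizes i : exists K, forall k, K <= k -> look i (log (c k)) = look i (log (c K)).
Proof.
  assert (Bd : forall k, rank (look i (log (c k))) <= 4 * limit_tries n i + 3).
  { intro k. pose proof (tries_bounded i k). unfold rank.
    destruct (phase _) as [|[|[|]]]; lia. }
  enough (G : forall d k, 4 * limit_tries n i + 3 - rank (look i (log (c k))) = d ->
    exists K, forall k, K <= k -> look i (log (c k)) = look i (log (c K)))
    by exact (G _ 0 eq_refl).
  induction d as [d IH] using lt_wf_ind; intros k Ed.
  destruct (classic (forall k', k <= k' -> look i (log (c k')) = look i (log (c k)))) as [H|H];
    [now exists k|].
  assert (G : exists k', rank (look i (log (c k))) < rank (look i (log (c k')))).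
  { apply not_all_ex_not in H. destruct H as [k' H]. apply imply_to_and in H.
    destruct H as [L N].
    enough (look i (log (c k')) = look i (log (c k)) \/
      rank (look i (log (c k))) < rank (look i (log (c k')))) as [?|?]; [easy|now exists k'|].
    clear N. induction L as [|k' L IHL]; [now left|].
    destruct (rank_step i k') as [->|R]; [easy|]. right.
    destruct IHL as [<-|]; lia. }
  destruct G as [k' G]. pose proof (Bd k').
  apply (IH (4 * limit_tries n i + 3 - rank (look i (log (c k'))))) with (k := k'); lia.
Qed.

Context (f : nat -> nat).
Context (f_stem : forall k, stem (c k) = prefix_of f (length (stem (c k)))).

Lemma walk_hits k a e v DD : fst (wait (c k)) = 0 -> In (stem (c k)) (snd (path (c k))) ->
  closed_plan a e [v] (width (c k)) (path (c k), DD) ->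
  exists N, sphi (prefix_of f N) a e v.
Proof.
  remember (max_length (snd (path (c k))) - length (stem (c k))) as d eqn:Ed.
  revert k Ed. induction d as [d IH] using lt_wf_ind; intros k Ed W I C.
  pose proof (C _ I) as Hs. cbn [fst snd] in Hs. apply orb_true_iff in Hs.
  destruct Hs as [Hs|B].
  { apply leafb_sphi in Hs. destruct Hs as (u & [<-|[]] & Hu).
    exists (length (stem (c k))). now rewrite <- f_stem. }
  destruct (walk_step k W B) as (u & Iu & E).
  pose proof (max_length_In _ _ Iu) as L. rewrite length_app in L. cbn in L.
  apply (IH (max_length (snd (path (c (S k)))) - length (stem (c (S k))))) with (k := S k);
    try easy; rewrite E; cbn [path stem wait width]; try easy.
  rewrite length_app. cbn. lia.
Qed.

Lemma met_hits i k : 3 <= phase (look i (log (c k))) ->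
  exists v N, phi (char empty) (prog (look i (log (c k)))) (prog (look i (log (c k)))) v /\
    sphi (prefix_of f N) (functional i) (prog (look i (log (c k)))) v.
Proof.
  induction k as [|k IH]; [cbn; lia|].
  destruct (state_S n Z k) as (m & g & v & [i' x' Ew Eh|k' i' x' Ew Hk Hk1 Eh|k' i' x' Ew Hk N1 N2
      |Ew B|Ew B _|i' Ew B T P|i' Ew B T P|i' Ew B T _ _ _] & _ & E).
  2:{ assert (El : log (c (S k)) = (i', Status (tries (look i' (log (c k)))) 3
        (prog (look i' (log (c k)))) (stem (c k)) (width (c k)) 0) :: log (c k)) by now rewrite E.
      rewrite El, look_cons. destruct (Nat.eqb_spec i' i) as [->|]; [|easy]. intros _. cbn [prog].
      apply hit_by_spec in Eh. destruct Eh as [Hp Hb]. apply bigb_iff_closed in Hb.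
      destruct Hb as [I C]. exists (fst (hit_cert x')).
      destruct (walk_hits (S k) (functional i) (prog (look i (log (c k))))
        (fst (hit_cert x')) (snd (fst (snd (snd (hit_cert x')))))) as [N HN].
      - now rewrite E.
      - rewrite E. exact I.
      - rewrite E. cbn [width path]. rewrite <- surjective_pairing. exact C.
      - exists N. easy. }
  all: rewrite E; cbn [log]; try exact IH; rewrite look_cons;
    (destruct (Nat.eqb_spec i' i); [cbn [phase]; lia|exact IH]).
Qed.

Lemma computes_no_bounded h g : computable h -> DNC_bounded h g -> ~ computable_in f g.
Proof.
  intros [b Hb] [Dg Bg] [a Ha]. set (i := npair a b).
  assert (Fi : functional i = a) by (unfold functional, i; now rewrite of_nat_npair).
  assert (Bi : bounding i = b) by (unfold bounding, i; now rewrite of_nat_npair).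
  destruct (stabilizes i) as [K HK]. set (s := look i (log (c K))) in HK.
  set (e := prog s).
  assert (Turn : forall x, clock (c K) <= x -> exists k, K <= k /\ normal (c k) /\
    turn (c k) = S i /\ snd (Cantor.of_nat (clock (c k))) = x) by (intros; now apply visited).
  assert (Refute : forall x, clock (c K) <= x ->
    phase s <> 0 /\ ~ (phase s = 1 /\ halts_by b e x = true) /\
    ~ (phase s = 2 /\ hit_by a e (at_width s) (at_stem s) x = true)).
  { intros x Lx. destruct (Turn x Lx) as (k & Lk & [W B] & T & X).
    pose proof (HK k Lk) as E1. pose proof (HK (S k) ltac:(lia)) as E2.
    destruct (state_S n Z k) as (m & gg & v & [i' x' Ew Eh|k' i' x' Ew Hk Hk1 Eh|k' i' x' Ew Hk N1 N2
      |Ew B'|Ew B' T'|i' Ew B' T' P|i' Ew B' T' P|i' Ew B' T' P P1 P2] & _ & E);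
      try congruence; try (rewrite Ew in W; cbn in W; congruence);
      assert (i' = i) by congruence; subst i'; rewrite E in E2; cbn [log] in E2;
      try (rewrite look_cons, Nat.eqb_refl in E2); rewrite E1 in *.
    - apply (f_equal phase) in E2. cbn [phase] in E2. congruence.
    - apply (f_equal phase) in E2. cbn [phase] in E2.
      destruct P as [[P _]|[P _]]; congruence.
    - rewrite Fi, Bi, X in *. fold e in P1, P2. split; [easy|]. split; intros [Q1 Q2].
      + rewrite P1 in Q2; easy.
      + rewrite P2 in Q2; easy. }
  destruct (state_inv n Z K) as [_ _ Ic _]. specialize (Ic i). fold s in Ic.
  destruct (phase s) as [|[|[|p]]] eqn:Ep.
  - now destruct (Refute _ (le_n _)).
  - destruct (halts_halts_by b e (clock (c K))) as (x & Lx & Hx); [now exists (h e)|].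
    destruct (Refute x Lx) as (_ & R & _). now apply R.
  - destruct (classic (hit_at i s)) as [Hh|Hh].
    + unfold hit_at in Hh. rewrite Fi in Hh. fold e in Hh.
      destruct (hit_hit_by _ _ _ _ (clock (c K)) Hh) as (x & Lx & Hx).
      destruct (Refute x Lx) as (_ & _ & R). now apply R.
    + destruct (Ic eq_refl) as [Hc _]. rewrite Bi in Hc. fold e in Hc.
      pose proof (phi_functional _ _ _ _ _ Hc (Hb e)) as Ecap.
      destruct (phi_sphi _ _ _ _ (Ha e)) as [N HN].
      destruct (stem_unbounded N K) as (k & Lk & LN).
      apply (unbroken k i). right. right. right. rewrite HK by easy.
      split; [easy|]. split; [easy|]. intro Av. apply Av. apply big_leaf.
      exists (g e). split; [rewrite Ecap; apply Bg|]. rewrite Fi. fold e.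
      rewrite f_stem. destruct (prefix_of_app f N (length (stem (c k))) LN) as [u ->].
      now apply sphi_app.
  - destruct (met_hits i K) as (v & N & Hp & Hs); [fold s; lia|]. 
    fold s in Hp, Hs. fold e in Hp, Hs.
    rewrite Fi in Hs. apply sphi_phi in Hs.
    rewrite (phi_functional _ _ _ _ _ Hs (Ha e)) in Hp. now apply (Dg e).
Qed.
End Outcome.

Lemma nth_prefix_of f n l : l < n -> nth l (prefix_of f n) 0 = f l.
Proof.
  intro L. unfold prefix_of.
  rewrite nth_indep with (d' := f 0) by (now rewrite length_map, length_seq).
  now rewrite map_nth, seq_nth.
Qed.

Lemma stem_computable n Z : (forall l, exists t, l < length (stem (at_time n Z t))) ->
  exists f, computable_in (char Z) f /\
    forall t, stem (at_time n Z t) = prefix_of f (length (stem (at_time n Z t))).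
Proof.
  intro T.
  assert (HZ : effective (char Z) (fun t : nat => initial Z t)).
  { apply (comp_ext (fun t => map (fun u => negb (char Z u =? 0)) (seq 0 t))).
    - intro t. apply map_ext. intro u. unfold char. now destruct (Z u).
    - apply (comp_map (fun _ u => negb (char Z u =? 0))); [|cmp].
      apply comp_negb, comp_eq0, comp_query. cmp. }
  assert (HS : effective (char Z) (fun t : nat => stem (at_time n Z t))) by (unfold at_time; cmp).
  assert (HS' : effective (char Z) (fun p : nat * nat => stem (at_time n Z (snd p)))).
  { apply (comp_comp (fun t => stem (at_time n Z t)) snd); [exact HS|cmp]. }
  destruct (search_code (O := char Z) (fun l t => l <? length (stem (at_time n Z t)))
    (fun l t => nth l (stem (at_time n Z t)) 0)) as [code Hcode].
  { apply comp_ltb; [cmp|]. now apply comp_length. }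
  { apply comp_nth; [cmp|easy]. }
  set (f := fun l => nth l (stem (at_time n Z
    (proj1_sig (constructive_indefinite_description _ (T l))))) 0).
  assert (Hf : forall t l, l < length (stem (at_time n Z t)) ->
    nth l (stem (at_time n Z t)) 0 = f l).
  { intros t l L. unfold f. destruct constructive_indefinite_description as [t' L']; cbn [proj1_sig].
    now apply at_time_nth. }
  exists f. split.
  - exists (encode code). intro l. exists code. split; [easy|].
    destruct (T l) as [t L]. destruct (proj1 (Hcode l) t) as (t' & L' & E); [now apply Nat.ltb_lt|].
    apply Nat.ltb_lt in L'. rewrite Hf in E by easy. exact E.
  - intro t. apply (nth_ext _ _ 0 0).
    + unfold prefix_of. now rewrite length_map, length_seq.
    + intros l L. rewrite Hf by easy. symmetry. now apply nth_prefix_of.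
Qed.

Theorem theorem5 (X Z : binseq) :
  ML_random X Z -> two_random Z ->
  exists f : nat -> nat,
    computable_in (char Z) f /\ DNC X f /\
    forall h : nat -> nat, computable h ->
      forall g : nat -> nat, DNC_bounded h g -> ~ computable_in f g.
Proof.
  intros HX H2. destruct (random_passes X Z HX H2) as [n Hn].
  assert (U : forall k i, ~ broken n i (state n Z k)).
  { intros k i. apply (Hn (block_time n Z k)). now rewrite block_time_fresh. }
  assert (T : forall l, exists k, l < length (stem (state n Z k))).
  { intro l. destruct (stem_unbounded n Z U (S l) 0) as (k & _ & L). now exists k. }
  destruct (stem_computable n Z) as (f & Cf & Sf).
  { intro l. destruct (T l) as [k L]. now exists (block_time n Z k). }
  exists f. split; [exact Cf|]. split.
  - intros l Hl. destruct (T l) as [k L].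
    apply (proj2 (Hn (block_time n Z k) ltac:(now rewrite block_time_fresh) l)).
    change (collision X l (state n Z k)). split; [exact L|].
    unfold state in *. rewrite Sf, nth_prefix_of; easy.
  - intros h Hh g Hg. apply (computes_no_bounded n Z U f) with (h := h); [|easy..].
    intro k. apply Sf.
Qed.
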